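(* Let $G$ be a finite connected graph with Hermitian edge weights and real potential, let $n\ge1$, let $H$ be an $n$-lift of $G$, and let $\mathcal T$ be their common universal cover, with density of states $\mu$. If $\lambda\in\operatorname{Spec}_pA_{\mathcal T}$, then (i) $\lambda\in\operatorname{Spec}A_G$ with multiplicity at least $|V(G)|\cdot\mu\{\lambda\}$, and (ii) $\lambda\in\operatorname{Spec}A_{H/G}$ with multiplicity at least $(n-1)\,|V(G)|\cdot\mu\{\lambda\}$, so that the multiplicity of $\lambda\in\operatorname{Spec}A_H$ is at least $n\,|V(G)|\cdot\mu\{\lambda\}$.
   Context: Graphs. A graph $G=(V,E,a,b)$ (self-loops and multi-edges allowed) has a vertex set $V$, a set $E$ of directed edges with a fixed-point-free direction-reversing involution $e\mapsto\check e$, source and terminal maps $\sigma,\tau:E\to V$ with $\sigma(e)=\tau(\check e)$, edge weights $a:E\to\mathbb C$ and potential $b:V\to\mathbb C$. For a vertex $u$, $\tau(u)$ also denotes the set of directed edges with terminal $u$. Weights and potential are Hermitian: $\overline{a_e}=a_{\check e}$ for all $e$, and $b$ is real. A non-backtracking walk is a sequence of edges $e_1,\dots,e_\ell$ with $\tau(e_s)=\sigma(e_{s+1})$ and $e_s\ne\check e_{s+1}$ for $1\le s\le \ell-1$. Lifts. An $n$-lift $H$ of $G$ is given by permutations $\pi_e\in\mathfrak S_n$, $e\in E$, with $\pi_{\check e}=\pi_e^{-1}$: $V(H)=V(G)\times\{1,\dots,n\}$, and for each $e\in E$ and each $i$ there is an edge $\tilde e$ of $H$ with source $(\sigma(e),i)$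 and terminal $(\tau(e),\pi_e(i))$; weights and potential are pulled back from $G$. Universal cover. The universal cover $\mathcal T=(\mathcal V,\mathcal E,\mathscr a,\mathscr b)$ of the connected graph $G$ is the (unique up to isomorphism) tree covering every cover of $G$; concretely, its vertices are the non-backtracking walks in $G$ starting at a fixed root (including the empty walk), two walks being joined by an edge (in both directions) when one extends the other by one edge. The covering map is $\Xi:\mathcal T\to G$, and $\mathscr a_{\tilde e}=a_{\Xi(\tilde e)}$, $\mathscr b_{\tilde v}=b_{\Xi(\tilde v)}$. It is also the universal cover of (each connected component of) $H$. Jacobi operators. $A_G$ acts on $\ell^2(V)$ by $(A_G\eta)(u)=b_u\eta(u)+\sum_{e\in\tau(u)}a_e\,\eta(\sigma(e))$; $A_H$ on $\ell^2(V(H))$ and the bounded self-adjoint operator $A_{\mathcal T}$ on $\ell^2(\mathcal V)$ are given by the same formula. Identifying $\ell^2(V(H))$ with $\ell^2(V)\otimes\mathbb C^n$ and writing $\pi_e$ also for the corresponding permutation operator on $\mathbb C^n$, $(A_H\eta)(u)=b_u\eta(u)+\sum_{e\in\tau(u)}a_e\pi_e\eta(\sigma(e))$. Let $\mathbb C^n_0$ be the orthogonal complement of the all-ones vector and $\rho(\pi_e)$ the restriction of $\pi_e$ to it. Then $A_H=A_G\oplus A_{H/G}$, where $A_{H/G}$ acts on $\ell^2(V)\otimes\mathbb C^n_0$ by $(A_{H/G}\eta)(u)=b_u\eta(u)+\sum_{e\in\tau(u)}a_e\rho(\pi_e)\eta(\sigma(e))$. The point spectrum is $\operatorname{Spec}_pA_{\mathcal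 T}=\{\lambda\in\mathbb R:\operatorname{Ker}(\lambda-A_{\mathcal T})\ne\{0\}\}$, with kernels in $\ell^2(\mathcal V)$. For $u\in V$, $\mu_u$ is the spectral measure with $\langle\delta_{\tilde u},f(A_{\mathcal T})\delta_{\tilde u}\rangle=\int f\,d\mu_u$ for every $\tilde u\in\Xi^{-1}(u)$ and bounded measurable $f$; the density of states is $\mu=\frac1{|V|}\sum_{u\in V}\mu_u$. ''$\lambda\in\operatorname{Spec}B$ with multiplicity at least $k$'' means $\dim\operatorname{Ker}(\lambda-B)\ge k$ (no condition when $k=0$, which in (ii) occurs only for $n=1$). *)

(* Defs.v *)
From HB Require Import structures.
From mathcomp Require Import all_boot all_order all_algebra.
From mathcomp Require Import fingroup perm.
From mathcomp.real_closed Require Import complex.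
From mathcomp Require Import all_classical all_reals all_analysis.

Set Implicit Arguments.
Unset Strict Implicit.
Unset Printing Implicit Defensive.

Import Order.TTheory GRing.Theory Num.Theory.
Import numFieldNormedType.Exports.

Local Open Scope classical_set_scope.
Local Open Scope complex_scope.
Local Open Scope ring_scope.

(* [V] and [E] are allowed to be infinite, so that the universal cover is
   again a [graph].  Edges are directed and [erev] reverses the direction. *)
Record graph (R : rcfType) (V E : choiceType) := Graph {
  erev : E -> E;
  src : E -> V;
  tgt : E -> V;
  wt : E -> R[i];
  pot : V -> R;
  erevK : involutive erev;
  erev_neq : forall e, erev e != e;
  src_erev : forall e, src e = tgt (erev e);
  wt_conj : forall e, conjc (wt e) = wt (erev e)
}.

Definition connected_graph (R : rcfType) (V E : finType) (G : graph R V E) :=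
  forall u v : V,
    connect (fun x y => [exists e, (src G e == x) && (tgt G e == y)]) u v.

(* The sum is a finitely supported big operator, hence the intended one as
   soon as [G] is locally finite; see [jacobi_finE] for finite graphs and
   [universal_cover_locally_finite] for the universal cover. *)
Definition jacobi (R : rcfType) (V E : choiceType) (G : graph R V E)
    (eta : V -> R[i]) (u : V) : R[i] :=
  (pot G u)%:C * eta u
  + \sum_(e \in [set e | tgt G e = u]) wt G e * eta (src G e).

Section FiniteJacobi.
Context {R : rcfType} {V E : finType} (G : graph R V E).

Lemma jacobi_finE (eta : V -> R[i]) u :
  jacobi G eta u =
  (pot G u)%:C * eta u + \sum_(e | tgt G e == u) wt G e * eta (src G e).
Proof.
rewrite /jacobi; congr (_ + _).
rewrite (bigfs _ (index_enum_uniq E)) => [|e _]; last by rewrite mem_index_enum.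
by congr (\sum_(e \in _) _); apply/seteqP; split=> e /= /eqP.
Qed.

Definition jacobi_fun (eta : {ffun V -> R[i]^o}) : {ffun V -> R[i]^o} :=
  [ffun u => jacobi G eta u].

Fact jacobi_fun_linear : linear jacobi_fun.
Proof.
move=> c f g; apply/ffunP => u; rewrite !ffunE !jacobi_finE !ffunE.
rewrite scalerDr addrACA scaler_sumr -big_split /= mulrDr mulrCA.
congr (_ + _); apply: eq_bigr => e _.
by rewrite !ffunE mulrDr mulrCA.
Qed.

HB.instance Definition _ := GRing.isLinear.Build R[i] {ffun V -> R[i]^o}
  {ffun V -> R[i]^o} _ jacobi_fun jacobi_fun_linear.

(* A_G as an endomorphism of l^2(V) = C^V *)
Definition jacobi_op : 'End({ffun V -> R[i]^o}) := linfun jacobi_fun.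

Lemma jacobi_opE (eta : {ffun V -> R[i]^o}) u :
  jacobi_op eta u = jacobi G eta u.
Proof. by rewrite /jacobi_op lfunE /= ffunE. Qed.

End FiniteJacobi.

(* dim Ker (lambda - A) *)
Definition multiplicity (R : rcfType) (W : vectType R[i]) (A : 'End(W))
    (lambda : R) : nat := \dim (lker (lambda%:C *: \1%VF - A)).

Record nlift (R : rcfType) (V E : finType) (G : graph R V E) (n : nat) :=
  NLift {
  lperm : E -> {perm 'I_n};
  lperm_erev : forall e, lperm (erev G e) = (lperm e)^-1%g
}.

Section Lift.
Context {R : rcfType} {V E : finType} {G : graph R V E} {n : nat}.
Variable H : nlift G n.

(* the edge (e, i) goes from (src e, i) to (tgt e, lperm e i) *)
Program Definition lift_graph : graph R (V * 'I_n)%type (E * 'I_n)%type :=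
  @Graph R _ _
    (fun x => (erev G x.1, lperm H x.1 x.2))
    (fun x => (src G x.1, x.2))
    (fun x => (tgt G x.1, lperm H x.1 x.2))
    (fun x => wt G x.1)
    (fun v => pot G v.1) _ _ _ _.
Next Obligation. by move=> [e i] /=; rewrite erevK lperm_erev permK. Qed.
Next Obligation.
by move=> [e i]; apply/eqP => -[/eqP]; rewrite (negPf (erev_neq G e)).
Qed.
Next Obligation. by move=> [e i] /=; rewrite -src_erev lperm_erev permK. Qed.
Next Obligation. by move=> [e i] /=; rewrite wt_conj. Qed.

(* C^n_0, the orthogonal complement of the all-ones vector *)
Definition ones_dot (x : {ffun 'I_n -> R[i]^o}) : R[i]^o := \sum_i x i.

Fact ones_dot_linear : linear ones_dot.
Proof.
move=> c x y; rewrite /ones_dot scaler_sumr -big_split /=.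
by apply: eq_bigr => i _; rewrite !ffunE.
Qed.

HB.instance Definition _ := GRing.isLinear.Build R[i] {ffun 'I_n -> R[i]^o}
  R[i]^o _ ones_dot ones_dot_linear.

Definition Cn0 : {vspace {ffun 'I_n -> R[i]^o}} := lker (linfun ones_dot).

Lemma mem_Cn0 x : (x \in Cn0) = (\sum_i x i == 0).
Proof. by rewrite memv_ker lfunE. Qed.

(* the permutation operator of s, with s delta_i = delta_(s i) *)
Definition perm_fun (s : {perm 'I_n}) (x : {ffun 'I_n -> R[i]^o}) :
  {ffun 'I_n -> R[i]^o} := [ffun j => x ((s^-1)%g j)].

Lemma perm_fun_Cn0 s x : x \in Cn0 -> perm_fun s x \in Cn0.
Proof.
rewrite !mem_Cn0 => /eqP x0; rewrite (reindex_inj (@perm_inj _ s)) /=.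
by under eq_bigr do rewrite ffunE permK; rewrite x0.
Qed.

(* rho(s), the restriction of the permutation operator to C^n_0 *)
Definition rho_fun (s : {perm 'I_n}) (x : subvs_of Cn0) : subvs_of Cn0 :=
  vsproj Cn0 (perm_fun s (vsval x)).

Fact rho_fun_linear s : linear (rho_fun s).
Proof.
move=> c x y; rewrite /rho_fun -linearP; congr (vsproj _ _).
by apply/ffunP => j; rewrite !ffunE.
Qed.

HB.instance Definition _ s := GRing.isLinear.Build R[i] (subvs_of Cn0)
  (subvs_of Cn0) _ (rho_fun s) (rho_fun_linear s).

Definition rho (s : {perm 'I_n}) : 'End(subvs_of Cn0) := linfun (rho_fun s).

Lemma rhoE s x : vsval (rho s x) = perm_fun s (vsval x).
Proof. by rewrite lfunE vsprojK// perm_fun_Cn0// subvsP. Qed.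

(* A_{H/G}; l^2(V) (x) C^n_0 is the space of C^n_0-valued functions on V *)
Definition quot_jacobi_fun (eta : {ffun V -> subvs_of Cn0}) :
    {ffun V -> subvs_of Cn0} :=
  [ffun u => (pot G u)%:C *: eta u
     + \sum_(e | tgt G e == u) wt G e *: rho (lperm H e) (eta (src G e))].

Fact quot_jacobi_fun_linear : linear quot_jacobi_fun.
Proof.
move=> c f g; apply/ffunP => u; rewrite !ffunE.
rewrite 2!scalerDr [RHS]addrACA scaler_sumr -big_split /= !scalerA.
rewrite [c * _]mulrC; congr (_ + _); apply: eq_bigr => e _.
by rewrite !ffunE linearP scalerDr !scalerA [c * _]mulrC.
Qed.

HB.instance Definition _ := GRing.isLinear.Build R[i]
  {ffun V -> subvs_of Cn0} {ffun V -> subvs_of Cn0} _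
  quot_jacobi_fun quot_jacobi_fun_linear.

Definition quot_jacobi_op : 'End({ffun V -> subvs_of Cn0}) :=
  linfun quot_jacobi_fun.

Lemma quot_jacobi_opE (eta : {ffun V -> subvs_of Cn0}) u :
  quot_jacobi_op eta u = (pot G u)%:C *: eta u
    + \sum_(e | tgt G e == u) wt G e *: rho (lperm H e) (eta (src G e)).
Proof. by rewrite /quot_jacobi_op lfunE ffunE. Qed.

End Lift.

Section Cover.
Context {R : rcfType} {V E : finType}.
Variables (G : graph R V E) (r : V).

Definition nbstep (e f : E) := (tgt G e == src G f) && (e != erev G f).

Definition nbwalk (s : seq E) : bool :=
  if s is e :: p then (src G e == r) && path nbstep e p else true.

Lemma nbwalk_rcons s e : nbwalk (rcons s e) -> nbwalk s.
Proof. by case: s => //= f p; rewrite rcons_path => /and3P[-> ->]. Qed.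

(* vertices of T: the non-backtracking walks starting at [r] *)
Definition cvert := {s : seq E | nbwalk s}.

(* Edges of T: [(s, e)] is the one-edge extension of the walk [s] to
   [rcons s e]; the boolean is [true] for the direction from [s] to
   [rcons s e] and [false] for the opposite one. *)
Definition cedge := {x : seq E * E * bool | nbwalk (rcons x.1.1 x.1.2)}.

Definition cedge_short (x : cedge) : cvert :=
  exist _ (val x).1.1 (nbwalk_rcons (valP x)).
Definition cedge_long (x : cedge) : cvert :=
  exist _ (rcons (val x).1.1 (val x).1.2) (valP x).
Definition cedge_rev (x : cedge) : cedge :=
  exist (fun x => is_true (nbwalk (rcons x.1.1 x.1.2)))
    ((val x).1, ~~ (val x).2) (valP x).

(* the covering map Xi *)
Definition cover_vert (w : cvert) : V := last r (map (tgt G) (val w)).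
Definition cover_edge (x : cedge) : E :=
  if (val x).2 then (val x).1.2 else erev G (val x).1.2.

Program Definition universal_cover : graph R cvert cedge :=
  @Graph R _ _ cedge_rev
    (fun x => if (val x).2 then cedge_short x else cedge_long x)
    (fun x => if (val x).2 then cedge_long x else cedge_short x)
    (fun x => wt G (cover_edge x))
    (fun w => pot G (cover_vert w)) _ _ _ _.
Next Obligation. by move=> [[[s e] d] p]; apply: val_inj; rewrite /= negbK. Qed.
Next Obligation.
by move=> x; apply/eqP => /(congr1 (fun x => (val x).2)) /=; case: (_.2).
Qed.
Next Obligation. by move=> [[[s e] []] p] /=; exact: val_inj. Qed.
Next Obligation.
by move=> [[[s e] []] p]; rewrite wt_conj /cover_edge /= ?erevK.
Qed.

Lemma universal_cover_locally_finite w :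
  finite_set [set x | tgt universal_cover x = w].
Proof.
pose p (x : cedge) := ((val x).1.2, (val x).2).
have pinj : {in [set x | tgt universal_cover x = w] &, injective p}.
  move=> [[[s e] d] ps] [[[t f] c] pt]; rewrite !inE /= => Hx Hy [ef dc].
  apply: val_inj; move: (congr1 val (etrans Hx (esym Hy))) => /=.
  rewrite {Hx Hy}; case: d c dc ps pt => -[]//= _ _ _.
    by case/rcons_inj=> ->; rewrite ef.
  by move=> ->; rewrite ef.
by rewrite -(eq_finite_set (inj_card_eq pinj)); exact: finite_finset.
Qed.

End Cover.

Section Ell2.
Context {R : realType} {X : choiceType}.
Implicit Types (h k : X -> R[i]) (A : (X -> R[i]) -> (X -> R[i])).

Definition normsq h : \bar R :=
  (\esum_(x in [set: X]) (Normc.normc (h x) ^+ 2)%:E)%E.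

Definition ell2 h : Prop := (normsq h < +oo)%E.

(* sum of an absolutely summable family *)
Definition rsum (f : X -> R) : R :=
  fine (\esum_(x in [set: X]) (Num.max (f x) 0)%:E)
  - fine (\esum_(x in [set: X]) (Num.max (- f x) 0)%:E).

Definition csum (f : X -> R[i]) : R[i] :=
  rsum (fun x => complex.Re (f x)) +i* rsum (fun x => complex.Im (f x)).

Definition inner h k : R[i] := csum (fun x => conjc (h x) * k x).

Definition delta (x : X) : X -> R[i] := fun y => (y == x)%:R.

Definition op_bound A (M : R) : Prop :=
  0 <= M /\ forall h, ell2 h -> (normsq (A h) <= (M ^+ 2)%:E * normsq h)%E.

Definition linear_on_ell2 A : Prop :=
  forall c h k, ell2 h -> ell2 k ->
    A (fun x => c * h x + k x) =1 (fun x => c * A h x + A k x).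

Definition point_spectrum A : set R :=
  [set lambda | exists h, [/\ ell2 h, exists x, h x != 0 &
                             A h =1 (fun x => lambda%:C * h x)]].

Definition bounded_borel (f : R -> R) : Prop :=
  measurable_fun [set: R] f /\ exists M, forall t, `|f t| <= M.

(* [Phi f] is f(A) for the bounded self-adjoint operator A: the bounded Borel
   functional calculus, which is uniquely determined by these properties.
   Since t |-> t is not bounded on R, [bc_id] is stated for the functions
   agreeing with it on an interval [-M, M] that contains the spectrum. *)
Record borel_calculus A (Phi : (R -> R) -> (X -> R[i]) -> (X -> R[i])) : Prop :=
  BorelCalculus {
  bc_op : forall f, bounded_borel f -> linear_on_ell2 (Phi f);
  bc_bound : forall f M, bounded_borel f -> (forall t, `|f t| <= M) ->
    op_bound (Phi f) M;
  bc_sa : forall f h k, bounded_borel f -> ell2 h -> ell2 k ->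
    inner (Phi f h) k = inner h (Phi f k);
  bc_lin : forall (c : R) f g h, bounded_borel f -> bounded_borel g -> ell2 h ->
    Phi (fun t => c * f t + g t) h =1 (fun x => c%:C * Phi f h x + Phi g h x);
  bc_one : forall h, ell2 h -> Phi (fun=> 1) h =1 h;
  bc_mul : forall f g h, bounded_borel f -> bounded_borel g -> ell2 h ->
    Phi (fun t => f t * g t) h =1 Phi f (Phi g h);
  bc_id : forall f M h, bounded_borel f -> op_bound A M ->
    (forall t, `|t| <= M -> f t = t) -> ell2 h -> Phi f h =1 A h;
  bc_cvg : forall (f_ : nat -> R -> R) f M h,
    (forall m, bounded_borel (f_ m)) -> bounded_borel f ->
    (forall m t, `|f_ m t| <= M) ->
    (forall t, (fun m => f_ m t) @ \oo --> f t) -> ell2 h ->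
    (fun m => normsq (fun x => Phi (f_ m) h x - Phi f h x)) @ \oo --> 0%E
}.

End Ell2.

(* [mu u] is the spectral measure mu_u of A_T, for every vertex u of G *)
Definition spectral_measures (R : realType) (V E : finType) (G : graph R V E)
    (r : V) (mu : V -> {measure set R -> \bar R}) : Prop :=
  exists Phi, borel_calculus (jacobi (universal_cover G r)) Phi /\
    forall (u : V) (w : cvert G r), cover_vert w = u ->
    forall f, bounded_borel f ->
      inner (delta w) (Phi f (delta w)) = (\int[mu u]_t f t)%:C.

Definition density_of_states (R : realType) (V : finType)
    (mu : V -> {measure set R -> \bar R}) (B : set R) : \bar R :=
  ((#|V|%:R^-1)%:E * \sum_(u : V) mu u B)%E.

(* Main.v *)
(* Let K be the l^2 kernel of lambda - A on the universal cover T.  For a vertex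
   w of T over u let g_w be the projection of delta_w to K, so that
   <g_w, k> = k(w) on K and |g_w|^2 = g_w(w) = mu_u{lambda} =: d u; call u
   charged when d u > 0.  For an edge e ending at u, let p e be the fraction of
   the mass of g_w carried by the branch of T behind e (seen from w).  Then:
   - the p e, over the edges e ending at a charged u, add up to 1 - d u;
   - if vectors g_i are linearly dependent and B_i are disjoint sets, the
     fractions of the mass of g_i carried by B_i add up to at most #I - 1.
     Applied to g_w and g_w' at the ends of an edge between charged vertices it
     gives p e + p (erev e) >= 1; applied around an uncharged vertex v, where
     every k in K vanishes, it gives that the p f over the edges f of non-zero
     weight from v to charged vertices add up to at least 1.
   Hence sum_u d u is at most #charged vertices - #edges between charged
   vertices - #uncharged vertices with a charged neighbour.  The right-hand side
   bounds from below the dimension (divided by dim W) of a space of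
   lambda-eigenvectors eta : V -> W for any action rho of the edges on W: by
   summation by parts, all k in K satisfy a_e k(src e) = t_e k(tgt e) along an
   edge e with a charged end tgt e, for a constant t_e, and it is enough that
   eta vanishes at the uncharged vertices, satisfies
   a_e rho_e eta(src e) = t_e eta(tgt e) once per edge between charged vertices,
   and one equation per uncharged vertex with a charged neighbour. *)
Require Import Defs.
From HB Require Import structures.
From mathcomp Require Import all_boot all_order all_algebra.
From mathcomp Require Import fingroup perm.
From mathcomp.real_closed Require Import complex.
From mathcomp Require Import all_classical all_reals all_analysis.
From mathcomp Require Import measurable_realfun.
From mathcomp Require Import ring lra zify.

Set Implicit Arguments.
Unset Strict Implicit.
Unset Printing Implicit Defensive.

Import Order.TTheory GRing.Theory Num.Theory.
Import numFieldNormedType.Exports.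

Local Open Scope classical_set_scope.
Local Open Scope complex_scope.
Local Open Scope ring_scope.

(** * Unordered sums of real families *)

Section RealSums.
Context {R : realType} {X : choiceType}.
Implicit Types (p q f g : X -> R).

Definition summableR f : Prop := (\esum_(x in [set: X]) `|f x|%:E < +oo)%E.

Lemma le_summableR f g : (forall x, `|f x| <= `|g x|) -> summableR g ->
  summableR f.
Proof.
by move=> fg; apply: le_lt_trans; apply: le_esum => x _; rewrite lee_fin.
Qed.

Lemma summableRD f g : summableR f -> summableR g ->
  summableR (fun x => f x + g x).
Proof.
move=> sf sg; apply: le_lt_trans (lte_add_pinfty sf sg).
rewrite -esumD; first by apply: le_esum => x _; rewrite -EFinD lee_fin ler_normD.
- by move=> x _; rewrite lee_fin.
- by move=> x _; rewrite lee_fin.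
Qed.

Lemma esumZ (c : R) p : 0 <= c -> (forall x, 0 <= p x) ->
  (\esum_(x in [set: X]) (c * p x)%:E = c%:E * \esum_(x in [set: X]) (p x)%:E)%E.
Proof.
move=> c0 p0; rewrite /esum -ereal_supZl//; last first.
  apply/set0P; exists (\sum_(x \in set0) (p x)%:E)%E; exists set0 => //.
congr ereal_sup; rewrite image_comp; apply: eq_imagel => A _ /=.
rewrite ge0_mule_fsumr; last by move=> x; rewrite lee_fin.
by apply: eq_fsbigr => x _; rewrite EFinM.
Qed.

Lemma summableRZ (c : R) f : summableR f -> summableR (fun x => c * f x).
Proof.
move=> sf; rewrite /summableR.
rewrite (_ : \esum_(_ in _) _ = (`|c|%:E * \esum_(x in [set: X]) `|f x|%:E)%E).
  rewrite lte_mul_pinfty ?lee_fin//.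
by rewrite -esumZ//; apply: eq_esum => x _; rewrite normrM.
Qed.

Lemma esum_fin_num p : (forall x, 0 <= p x) -> summableR p ->
  (\esum_(x in [set: X]) (p x)%:E \is a fin_num)%E.
Proof.
move=> p0 sp; rewrite ge0_fin_numE; last first.
  by apply: esum_ge0 => x _; rewrite lee_fin.
apply: le_lt_trans sp; apply: le_esum => x _.
by rewrite lee_fin ler_norm.
Qed.

Lemma rsum_ge0E p : (forall x, 0 <= p x) ->
  rsum p = fine (\esum_(x in [set: X]) (p x)%:E).
Proof.
move=> p0; rewrite /rsum [X in _ - fine X]esum1 ?subr0; last first.
  by move=> x _; rewrite max_r// oppr_le0.
by congr fine; apply: eq_esum => x _; rewrite max_l.
Qed.

(** [rsum] can be computed from any splitting into non-negative summable parts, not just the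
    canonical one: with f = p - q, the positive part of f plus q equals p plus the negative part of
    f. Additivity of [rsum] follows from this. *)
Lemma rsum_diff p q : (forall x, 0 <= p x) -> (forall x, 0 <= q x) ->
  summableR p -> summableR q ->
  rsum (fun x => p x - q x) =
  fine (\esum_(x in [set: X]) (p x)%:E) - fine (\esum_(x in [set: X]) (q x)%:E).
Proof.
move=> p0 q0 sp sq; rewrite /rsum.
have spq : summableR (fun x => p x - q x).
  have := summableRD sp (summableRZ (-1) sq).
  by apply: le_summableR => x; rewrite mulN1r.
set f := fun x => p x - q x in spq *.
have sf1 : summableR (fun x => Num.max (f x) 0).
  apply: le_summableR spq => x.
  by case: (lerP (f x) 0) => // _; rewrite normr0.
have sf2 : summableR (fun x => Num.max (- f x) 0).
  apply: le_summableR spq => x.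
  by case: (lerP (- f x) 0) => // _; rewrite ?normrN// normr0.
have m0 g x : 0 <= Num.max (g x) 0 :> R by rewrite le_max lexx orbT.
have e0 g : (forall x, 0 <= g x) -> forall x, [set: X] x -> (0 <= (g x)%:E)%E.
  by move=> h x _; rewrite lee_fin.
apply/eqP; rewrite subr_eq addrAC eq_sym subr_eq; apply/eqP.
rewrite -!fineD ?esum_fin_num//; [|exact: (m0 f)|exact: (m0 (fun x => - f x))].
congr fine; rewrite -!esumD//;
  try by apply: e0 => //; first [exact: (m0 f)|exact: (m0 (fun x => - f x))].
apply: eq_esum => x _; rewrite -!EFinD; congr EFin; rewrite /f.
by case: (lerP (p x - q x) 0); case: (lerP (- (p x - q x)) 0); lra.
Qed.

Lemma summableR_pos f : summableR f -> summableR (fun x => Num.max (f x) 0).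
Proof.
apply: le_summableR => x.
by case: (lerP (f x) 0) => // _; rewrite normr0. Qed.

Lemma summableRN f : summableR f -> summableR (fun x => - f x).
Proof. by apply: le_summableR => x; rewrite normrN. Qed.

Lemma rsumN f : rsum (fun x => - f x) = - rsum f.
Proof.
rewrite /rsum opprB; congr (fine _ - fine _).
by apply: eq_esum => x _; rewrite opprK.
Qed.

Lemma rsumD f g : summableR f -> summableR g ->
  rsum (fun x => f x + g x) = rsum f + rsum g.
Proof.
move=> sf sg; have sNf := summableRN sf; have sNg := summableRN sg.
have m0 h x : 0 <= Num.max (h x) 0 :> R by rewrite le_max lexx orbT.
have -> : (fun x => f x + g x) = (fun x => (Num.max (f x) 0 + Num.max (g x) 0)
    - (Num.max (- f x) 0 + Num.max (- g x) 0)).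
  apply/funext => x; case: (lerP (f x) 0); case: (lerP (g x) 0);
  case: (lerP (- f x) 0); case: (lerP (- g x) 0); lra.
rewrite rsum_diff; [|by move=> x; rewrite addr_ge0|by move=> x; rewrite addr_ge0|
  by apply: summableRD; apply: summableR_pos|
  by apply: summableRD; apply: (@summableR_pos (fun x => - _ x))].
rewrite /rsum.
under eq_esum do rewrite EFinD.
rewrite esumD; [|by move=> x _; rewrite lee_fin|by move=> x _; rewrite lee_fin].
under [X in _ - fine X]eq_esum do rewrite EFinD.
rewrite esumD; [|by move=> x _; rewrite lee_fin|by move=> x _; rewrite lee_fin].
rewrite !fineD; first by rewrite opprD addrACA.
all: by apply: esum_fin_num; [by move=> x; rewrite le_max lexx orbT |
  first [exact: summableR_pos sf|exact: summableR_pos sg|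
         exact: summableR_pos sNf|exact: summableR_pos sNg]].
Qed.

Lemma rsumZ (c : R) f : summableR f -> rsum (fun x => c * f x) = c * rsum f.
Proof.
move=> sf; have m0 h x : 0 <= Num.max (h x) 0 :> R by rewrite le_max lexx orbT.
(* A negative [c] exchanges the positive and negative parts; [rsumN] reduces it to [- c]. *)
wlog c0 : c / 0 <= c.
  move=> hw; case: (lerP 0 c) => [/hw//|c0].
  rewrite -[RHS]opprK -mulNr -hw ?oppr_ge0 1?ltW// -rsumN.
  by congr rsum; apply/funext => x; rewrite mulNr opprK.
have fZ p : (forall x, 0 <= p x) -> summableR p ->
    fine (\esum_(x in [set: X]) (c * p x)%:E) =
    c * fine (\esum_(x in [set: X]) (p x)%:E).
  by move=> p0 sp; rewrite esumZ// fineM//; exact: esum_fin_num.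
rewrite /rsum mulrBr -(fZ (fun x => Num.max (f x) 0)); last 2 first.
- by move=> x; rewrite le_max lexx orbT.
- exact: summableR_pos.
rewrite -(fZ (fun x => Num.max (- f x) 0)); last 2 first.
- by move=> x; rewrite le_max lexx orbT.
- exact: summableR_pos (summableRN sf).
congr (fine _ - fine _); apply: eq_esum => x _; congr EFin.
- by rewrite maxr_pMr// mulr0.
- by rewrite maxr_pMr// mulr0 mulrN.
Qed.

End RealSums.

(** * Morphism laws of complex conjugation, stated for rewriting *)

Lemma conjcM (R : rcfType) (x y : R[i]) : conjc (x * y) = conjc x * conjc y.
Proof. exact: rmorphM. Qed.

Lemma conjcD (R : rcfType) (x y : R[i]) : conjc (x + y) = conjc x + conjc y.
Proof. exact: rmorphD. Qed.

Lemma conjcN (R : rcfType) (x : R[i]) : conjc (- x) = - conjc x.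
Proof. exact: rmorphN. Qed.

Lemma conjc_sum (R : rcfType) (I : Type) (r : seq I) (P : pred I) (F : I -> R[i]) :
  conjc (\sum_(i <- r | P i) F i) = \sum_(i <- r | P i) conjc (F i).
Proof. exact: rmorph_sum. Qed.

(** * The space l^2: inner product, restriction to subsets, Cauchy-Schwarz *)

Section HilbertSums.
Context {R : realType} {X : choiceType}.
Implicit Types (h k l : X -> R[i]).

Let normc_sqE (z : R[i]) :
  Normc.normc z ^+ 2 = (complex.Re z) ^+ 2 + (complex.Im z) ^+ 2.
Proof. by case: z => a b /=; rewrite sqr_sqrtr ?addr_ge0 ?sqr_ge0. Qed.

Lemma mul_conjc (z : R[i]) : z * conjc z = (Normc.normc z ^+ 2)%:C.
Proof.
rewrite normc_sqE; case: z => a b; apply/eqP; rewrite eq_complex /= !expr2.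
by apply/andP; split; apply/eqP; ring.
Qed.

Definition summableC h : Prop :=
  summableR (fun x => complex.Re (h x)) /\ summableR (fun x => complex.Im (h x)).

Lemma csumP (c : R[i]) h k : summableC h -> summableC k ->
  csum (fun x => c * h x + k x) = c * csum h + csum k.
Proof.
case: c => a b [hr hi] [kr ki]; rewrite /csum.
have -> : (fun x => complex.Re ((a +i* b) * h x + k x)) =
  (fun x => (a * complex.Re (h x) + (- b) * complex.Im (h x)) + complex.Re (k x)).
  by apply/funext => x; case: (h x) (k x) => [? ?] [? ?] /=; rewrite mulNr.
have -> : (fun x => complex.Im ((a +i* b) * h x + k x)) =
  (fun x => (a * complex.Im (h x) + b * complex.Re (h x)) + complex.Im (k x)).
  by apply/funext => x; case: (h x) (k x) => [? ?] [? ?] /=.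
have rD3 u v (f g l : X -> R) : summableR f -> summableR g -> summableR l ->
    rsum (fun x => u * f x + v * g x + l x) =
    u * rsum f + v * rsum g + rsum l.
  move=> sf sg sl; rewrite (@rsumD _ _ (fun x => u * f x + v * g x))//; last first.
    by apply: summableRD; exact: summableRZ.
  by rewrite rsumD ?rsumZ//; exact: summableRZ.
rewrite !rD3//.
by apply/eqP; rewrite eq_complex /= mulNr !eqxx.
Qed.

Lemma csum_conjc h : csum (fun x => conjc (h x)) = conjc (csum h).
Proof.
apply/eqP; rewrite eq_complex /= -rsumN; apply/andP; split; apply/eqP; congr rsum.
  by apply/funext => x; case: (h x).
by apply/funext => x; case: (h x).
Qed.

(** The real and imaginary parts of each term are bounded by |h x|^2 + |k x|^2. *)
Lemma summableC_ell2 h k : ell2 h -> ell2 k ->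
  summableC (fun x => conjc (h x) * k x).
Proof.
move=> hh kk.
have s : summableR (fun x => Normc.normc (h x) ^+ 2 + Normc.normc (k x) ^+ 2).
  apply: (@summableRD _ _ (fun x => Normc.normc (h x) ^+ 2)).
  - by apply: le_lt_trans hh; apply: le_esum => x _; rewrite ger0_norm ?sqr_ge0.
  - by apply: le_lt_trans kk; apply: le_esum => x _; rewrite ger0_norm ?sqr_ge0.
split; apply: le_summableR s => x; rewrite [leRHS]ger0_norm ?addr_ge0 ?sqr_ge0//;
  rewrite !normc_sqE; case: (h x) (k x) => [a b] [c d] /=.
- have := sqr_ge0 (a - c); have := sqr_ge0 (a + c);
  have := sqr_ge0 (b - d); have := sqr_ge0 (b + d).
  by rewrite ler_norml => *; apply/andP; split; nra.
- have := sqr_ge0 (a - d); have := sqr_ge0 (a + d);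
  have := sqr_ge0 (b - c); have := sqr_ge0 (b + c).
  by rewrite ler_norml => *; apply/andP; split; nra.
Qed.

Lemma normsq_ge0 h : (0 <= normsq h)%E.
Proof. by apply: esum_ge0 => x _; rewrite lee_fin sqr_ge0. Qed.

Lemma ell2Z (c : R[i]) h : ell2 h -> ell2 (fun x => c * h x).
Proof.
move=> hh; rewrite /ell2 /normsq.
under eq_esum do rewrite Normc.normcM exprMn.
by rewrite esumZ ?sqr_ge0// ?lte_mul_pinfty ?lee_fin ?sqr_ge0// => x; rewrite sqr_ge0.
Qed.

(** The pointwise bound |a + b|^2 <= 2 |a|^2 + 2 |b|^2; it is cruder than the triangle inequality
    but enough for l^2 to be a vector space and for sums of bounded operators. *)
Lemma normsqD_le h k :
  (normsq (fun x => h x + k x)%R <= 2%:E * normsq h + 2%:E * normsq k)%E.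
Proof.
have n0 l x : 0 <= Normc.normc (l x : R[i]) ^+ 2 :> R by exact: sqr_ge0.
rewrite /normsq -(esumZ (ler0n R 2) (n0 h)) -(esumZ (ler0n R 2) (n0 k)).
rewrite -esumD; [|by move=> x _; rewrite lee_fin mulr_ge0|
  by move=> x _; rewrite lee_fin mulr_ge0].
apply: le_esum => x _; rewrite -EFinD lee_fin !normc_sqE.
case: (h x) (k x) => [a b] [c d] /=.
have := sqr_ge0 (a - c); have := sqr_ge0 (b - d); nra.
Qed.

Lemma ell2D h k : ell2 h -> ell2 k -> ell2 (fun x => h x + k x).
Proof.
move=> hh kk; apply: le_lt_trans (normsqD_le h k) _.
by apply: lte_add_pinfty; apply: lte_mul_pinfty.
Qed.

Lemma ell2P (c : R[i]) h k : ell2 h -> ell2 k -> ell2 (fun x => c * h x + k x).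
Proof. by move=> hh kk; apply: ell2D => //; apply: ell2Z. Qed.

Lemma ell20 : ell2 (fun _ : X => 0 : R[i]).
Proof.
by rewrite /ell2 /normsq esum1// => x _; rewrite Normc.normc0 expr0n.
Qed.

Lemma ell2_sum (I : Type) (r : seq I) (P : pred I) (c : I -> R[i])
    (F : I -> X -> R[i]) :
  (forall i, P i -> ell2 (F i)) -> ell2 (fun x => \sum_(i <- r | P i) c i * F i x).
Proof.
move=> hF; elim: r => [|i r IH].
  by under eq_fun do rewrite big_nil; exact: ell20.
under eq_fun do rewrite big_cons.
case Pi: (P i); last exact: IH.
by apply: ell2P => //; exact: hF.
Qed.

Lemma ell2_le h k : (forall x, Normc.normc (h x) <= Normc.normc (k x)) ->
  ell2 k -> ell2 h.
Proof.
move=> hk; apply: le_lt_trans; apply: le_esum => x _; rewrite lee_fin.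
by rewrite lerXn2r ?nnegrE// ?hk//; [case: (h x)|case: (k x)] => a b /=;
  rewrite sqrtr_ge0.
Qed.

Definition restr (B : X -> bool) h : X -> R[i] := fun x => if B x then h x else 0.

Lemma ell2_restr B h : ell2 h -> ell2 (restr B h).
Proof.
apply: ell2_le => x; rewrite /restr; case: ifP => // _.
by rewrite Normc.normc0; case: (h x) => a b /=; rewrite sqrtr_ge0.
Qed.

Lemma ell2_delta (x : X) : ell2 (delta x : X -> R[i]).
Proof.
rewrite /ell2 /normsq (esumID [set x]); last by move=> *; rewrite lee_fin sqr_ge0.
rewrite setTI setTI esum_set1 ?lee_fin ?sqr_ge0// esum1 ?adde0 ?ltry//.
by move=> y /= /eqP xy; rewrite /delta (negPf xy) Normc.normc0 expr0n.
Qed.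

Lemma inner_linr (c : R[i]) h k l : ell2 h -> ell2 k -> ell2 l ->
  inner h (fun x => c * k x + l x) = c * inner h k + inner h l.
Proof.
move=> hh hk hl; rewrite /inner -csumP; try exact: summableC_ell2.
by congr csum; apply/funext => x; rewrite mulrDr mulrCA.
Qed.

Lemma inner_conj h k : inner k h = conjc (inner h k).
Proof.
rewrite /inner -csum_conjc; congr csum; apply/funext => x.
by rewrite conjcM conjcK mulrC.
Qed.

Lemma inner_linl (c : R[i]) h k l : ell2 h -> ell2 k -> ell2 l ->
  inner (fun x => c * k x + l x) h = conjc c * inner k h + inner l h.
Proof.
by move=> hh hk hl; rewrite inner_conj inner_linr// conjcD conjcM -!inner_conj.
Qed.

Definition sqn h : R := fine (normsq h).

Lemma sqn_ge0 h : 0 <= sqn h.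
Proof. by rewrite fine_ge0 ?normsq_ge0. Qed.

Lemma normsqE h : ell2 h -> normsq h = (sqn h)%:E.
Proof. by move=> hh; rewrite fineK// ge0_fin_numE ?normsq_ge0. Qed.

Lemma inner_self h : inner h h = (sqn h)%:C.
Proof.
rewrite /inner /csum; have -> : (fun x => complex.Im (conjc (h x) * h x)) = fun=> 0.
  by apply/funext => x; case: (h x) => a b /=; rewrite mulNr mulrC subrr.
have -> : (fun x => complex.Re (conjc (h x) * h x)) =
   (fun x => Normc.normc (h x) ^+ 2).
  apply/funext => x; rewrite normc_sqE; case: (h x) => a b /=.
  by rewrite !expr2 mulNr opprK.
rewrite !rsum_ge0E//; last by move=> x; rewrite sqr_ge0.
by rewrite [X in _ +i* fine X]esum1.
Qed.

Lemma normc_sq_eq0 (z : R[i]) : Normc.normc z ^+ 2 = 0 -> z = 0.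
Proof. by move/eqP; rewrite sqrf_eq0 => /eqP /Normc.eq0_normc. Qed.

Lemma normc_le_sqn h x : ell2 h -> Normc.normc (h x) ^+ 2 <= sqn h.
Proof.
move=> hh; rewrite -lee_fin -normsqE// /normsq (esumID [set x]); last first.
  by move=> *; rewrite lee_fin sqr_ge0.
rewrite setTI esum_set1 ?lee_fin ?sqr_ge0// leeDl//.
by apply: esum_ge0 => y _; rewrite lee_fin sqr_ge0.
Qed.

Lemma sqn_eq0 h : ell2 h -> sqn h = 0 -> forall x, h x = 0.
Proof.
move=> hh h0 x; apply: normc_sq_eq0; apply/eqP; rewrite eq_le sqr_ge0 andbT -h0.
exact: normc_le_sqn.
Qed.

Lemma inner0l k : inner (fun _ : X => 0) k = 0.
Proof.
rewrite /inner; under eq_fun do rewrite conjc0 mul0r.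
by rewrite /csum rsum_ge0E// esum1.
Qed.

Lemma inner0r k : inner k (fun _ : X => 0) = 0.
Proof. by rewrite inner_conj inner0l conjc0. Qed.

Lemma inner_sumr (I : Type) (r : seq I) (P : pred I) (c : I -> R[i])
    (F : I -> X -> R[i]) h : ell2 h -> (forall i, P i -> ell2 (F i)) ->
  inner h (fun x => \sum_(i <- r | P i) c i * F i x) =
  \sum_(i <- r | P i) c i * inner h (F i).
Proof.
move=> hh hF; elim: r => [|i r IH].
  by under eq_fun do rewrite big_nil; rewrite big_nil inner0r.
under eq_fun do rewrite big_cons.
rewrite big_cons; case Pi: (P i); last exact: IH.
by rewrite inner_linr ?IH//; [exact: hF | exact: ell2_sum].
Qed.

Lemma inner_restr B h k : inner (restr B h) k = inner (restr B h) (restr B k).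
Proof.
rewrite /inner; congr csum; apply/funext => x; rewrite /restr.
by case: ifP => //; rewrite conjc0 !mul0r.
Qed.

Lemma inner_restr_disj (B B' : X -> bool) h k : (forall x, B x -> B' x -> False) ->
  inner (restr B h) (restr B' k) = 0.
Proof.
move=> BB'; rewrite /inner (_ : (fun x => _) = fun=> 0) ?/csum ?rsum_ge0E ?esum1//.
apply/funext => x; rewrite /restr; case: ifP => [b|]; last by rewrite conjc0 mul0r.
by case: ifP => [/(BB' _ b)//|]; rewrite mulr0.
Qed.

Lemma sqn_linE (c : R[i]) h k : ell2 h -> ell2 k ->
  (sqn (fun x => c * h x + k x))%:C = c * conjc c * (sqn h)%:C + (sqn k)%:C
    + (c * inner k h + conjc (c * inner k h)).
Proof.
move=> hh hk; rewrite -inner_self inner_linr ?inner_linl//; last exact: ell2P.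
rewrite !inner_self conjcM -inner_conj; ring.
Qed.

Lemma cauchy_schwarz h k : ell2 h -> ell2 k ->
  Normc.normc (inner h k) ^+ 2 <= sqn h * sqn k.
Proof.
move=> hh hk; case: (eqVneq (sqn h) 0) => [h0|h0].
  have -> : h = fun=> 0 by apply/funext; exact: sqn_eq0.
  by rewrite inner0l Normc.normc0 expr0n mulr_ge0 ?sqn_ge0.
have hp : 0 < sqn h by rewrite lt_def h0 sqn_ge0.
(* The coefficient that makes [c * h + k] orthogonal to [h]; the inequality says that the squared
   norm of this vector is non-negative. *)
pose c : R[i] := - (inner h k / (sqn h)%:C).
have := sqn_ge0 (fun x => c * h x + k x).
rewrite -lecR sqn_linE// [inner k h]inner_conj.
have -> : conjc (c * conjc (inner h k)) = conjc c * inner h k.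
  by rewrite conjcM conjcK.
have -> : conjc c = - (conjc (inner h k) / (sqn h)%:C).
  rewrite /c conjcN conjcM conjc_inv; congr (- (_ * _^-1)); exact: conjc_real.
set z := inner h k; set zc := conjc z.
have hC : (sqn h)%:C != 0 :> R[i].
  by rewrite -(rmorph0 (real_complex R)) (inj_eq (@complexI R)).
have -> : c * - (zc / (sqn h)%:C) * (sqn h)%:C + (sqn k)%:C +
  (c * zc + - (zc / (sqn h)%:C) * z) = (sqn k)%:C - (z * zc) / (sqn h)%:C.
  by rewrite /c -/z; field.
rewrite mul_conjc.
rewrite -rmorphV ?unitfE// -rmorphM -rmorphB /= lecR subr_ge0 ler_pdivrMr//.
by rewrite mulrC.
Qed.

End HilbertSums.

(** * Linear dependence against disjoint supports *)

Section TraceBound.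
Context {R : realType} {X : choiceType}.

(** A square matrix and its transpose have the same determinant, so dependent columns force
    dependent rows. *)
Lemma singular_left_kernel (I : finType) (M : I -> I -> R[i]) (c : I -> R[i]) i0 :
  c i0 != 0 -> (forall i, \sum_j c j * M i j = 0) ->
  exists2 z : I -> R[i], (exists i, z i != 0) &
    forall j, \sum_i z i * M i j = 0.
Proof.
move=> ci0 cM.
pose A : 'M[R[i]]_#|I| := \matrix_(i, j) M (enum_val i) (enum_val j).
have : \det A^T == 0.
  apply/det0P; exists (\row_j c (enum_val j)).
    apply/negP => /eqP /rowP /(_ (enum_rank i0)).
    by rewrite !mxE enum_rankK => /eqP; exact/negP.
  apply/rowP => i; rewrite !mxE -[RHS](cM (enum_val i)).
  rewrite [RHS](reindex (@enum_val I predT)) /=; last first.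
    by apply: onW_bij; exact: enum_val_bij.
  by apply: eq_bigr => j _; rewrite !mxE.
rewrite det_tr => /det0P[v v0 vA]; exists (fun i => v 0 (enum_rank i)).
  case/rV0Pn: v0 => i vi; exists (enum_val i); by rewrite enum_valK.
move=> j; move/rowP: vA => /(_ (enum_rank j)); rewrite !mxE => h; rewrite -[RHS]h.
rewrite (reindex (@enum_val I predT)) /=; last first.
  by apply: onW_bij; exact: enum_val_bij.
by apply: eq_bigr => i _; rewrite !mxE enum_valK enum_rankK.
Qed.

(* There is a non-zero [Y] in the span of the pairwise orthogonal
   [y i = restr (B i) (g i)] that is orthogonal to all the [g j]; remove from
   [y j] its component along [Y] and apply Cauchy-Schwarz with [g j]. *)
Lemma trace_bound (I : finType) (g : I -> X -> R[i]) (B : I -> X -> bool)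
    (c : I -> R[i]) i0 :
  (forall i, ell2 (g i)) -> (forall i j x, B i x -> B j x -> i = j) ->
  c i0 != 0 -> (forall x, \sum_i c i * g i x = 0) ->
  (forall i, 0 < sqn (restr (B i) (g i))) ->
  \sum_i sqn (restr (B i) (g i)) / sqn (g i) <= #|I|%:R - 1.
Proof.
move=> lg dB ci0 cg mp.
pose y i := restr (B i) (g i); pose m i := sqn (y i).
have ly i : ell2 (y i) by exact: ell2_restr.
have yg j : inner (y j) (g j) = (m j)%:C by rewrite inner_restr inner_self.
have yy i j : i != j -> inner (y i) (y j) = 0.
  move=> ij; apply: inner_restr_disj => x Bi Bj.
  by move: ij; rewrite (dB _ _ _ Bi Bj) eqxx.
(* The dependence between the [g j] makes the matrix of the [inner (y i) (g j)] singular; a left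
   kernel vector provides the coefficients of [Y]. *)
have [i|z [k0 zk0] zM] :=
    @singular_left_kernel I (fun i j => inner (y i) (g j)) c i0 ci0.
  by rewrite -inner_sumr// (_ : (fun x => _) = fun=> 0) ?inner0r//; exact/funext.
pose Y x := \sum_i conjc (z i) * y i x.
have lY : ell2 Y by exact: ell2_sum.
have Yg j : inner Y (g j) = 0.
  rewrite inner_conj inner_sumr// conjc_sum -[RHS](zM j).
  by apply: eq_bigr => i _; rewrite conjcM conjcK -inner_conj.
have Yy j : inner Y (y j) = z j * (m j)%:C.
  rewrite inner_conj inner_sumr// (bigD1 j)//= big1 ?addr0; last first.
    by move=> i ij; rewrite yy ?mulr0// eq_sym.
  by rewrite inner_self conjcM conjcK conjc_real.
pose n i := Normc.normc (z i) ^+ 2.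
have SE : sqn Y = \sum_i n i * m i.
  apply: (@complexI R); rewrite -inner_self {2}/Y inner_sumr// rmorph_sum /=.
  apply: eq_bigr => i _; rewrite Yy mulrA [conjc _ * _]mulrC mul_conjc.
  by rewrite -rmorphM.
have n0 i : 0 <= n i by exact: sqr_ge0.
have Sp : 0 < sqn Y.
  rewrite SE (bigD1 k0)//= ltr_pwDl//; last first.
    by apply: sumr_ge0 => i _; rewrite mulr_ge0// ltW// mp.
  rewrite mulr_gt0 ?mp// lt_def (n0 k0) andbT; apply: contra zk0 => /eqP.
  by move/normc_sq_eq0 => ->.
have key j : m j / sqn (g j) <= 1 - n j * m j / sqn Y.
  pose a : R[i] := - (z j * (m j)%:C / (sqn Y)%:C).
  have wg : inner (fun x => a * Y x + y j x) (g j) = (m j)%:C.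
    by rewrite inner_linl// Yg mulr0 add0r yg.
  have lw : ell2 (fun x => a * Y x + y j x) by exact: ell2P.
  have := cauchy_schwarz lw (lg j); rewrite wg.
  have -> : sqn (fun x => a * Y x + y j x) = m j - n j * m j ^+ 2 / sqn Y.
    apply: (@complexI R); rewrite sqn_linE// [inner (y j) Y]inner_conj Yy -/(m j).
    have hS : (sqn Y)%:C != 0 :> R[i].
      by rewrite -(rmorph0 (real_complex R)) (inj_eq (@complexI R)) gt_eqF.
    have ca : conjc a = - (conjc (z j) * (m j)%:C / (sqn Y)%:C).
      by rewrite conjcN !conjcM conjc_inv !conjc_real.
    rewrite [conjc (a * _)]conjcM conjcK ca conjcM conjc_real /a.
    have rcE (p q r s : R) : (p - q * r ^+ 2 / s)%:C =
        p%:C - q%:C * r%:C ^+ 2 / s%:C :> R[i].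
      by rewrite rmorphB !rmorphM /= fmorphV expr2.
    rewrite rcE /n -mul_conjc.
    by field.
  have -> : Normc.normc (m j)%:C ^+ 2 = m j ^+ 2.
    by rewrite /= expr0n addr0 sqr_sqrtr ?sqr_ge0.
  have gp : 0 < sqn (g j).
    rewrite lt_def sqn_ge0 andbT; apply/eqP => /(sqn_eq0 (lg j)) g0.
    have := mp j; rewrite (_ : restr _ _ = fun=> 0) ?/sqn ?/normsq ?esum1 ?ltxx//.
      by move=> x _; rewrite Normc.normc0 expr0n.
    by apply/funext => x; rewrite /restr g0 if_same.
  move=> h; rewrite ler_pdivrMr// -(ler_pM2l (mp j)) -/(y j) -/(m j).
  rewrite -expr2; apply: (le_trans h).
  by rewrite le_eqVlt; apply/orP; left; apply/eqP; ring.
(* By [SE] the fractions [n j * m j / sqn Y] add up to 1, which is the gain over the trivial bound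
   [#|I|]. *)
rewrite (le_trans (ler_sum _ (fun j _ => key j)))// sumrB sumr_const -mulr_suml -SE.
by rewrite divff ?gt_eqF.
Qed.

End TraceBound.

(** * Moves of non-backtracking walks at either end *)

Section WalkMoves.
Context {R : rcfType} {V E : finType} (G : graph R V E).
Implicit Types (s : seq E) (e f : E) (u v r : V).

Local Notation bar := (erev G).

Definition walk_end r s : V := last r (map (tgt G) s).

(* The end of the edge of the cover over [f] that leaves [s].  For [s] empty,
   [last f s = f] differs from [bar f]. *)
Definition mv s f : seq E :=
  if last f s == bar f then take (size s).-1 s else rcons s f.

(* Change of root from [tgt e] to [src e]. *)
Definition lmv e s : seq E :=
  if s is x :: s' then if x == bar e then s' else e :: s else [:: e].

Lemma src_bar e : src G (bar e) = tgt G e.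
Proof. by rewrite src_erev erevK. Qed.

Lemma tgt_bar e : tgt G (bar e) = src G e.
Proof. by rewrite src_erev. Qed.

Lemma bar_neq e : (e == bar e) = false.
Proof. by rewrite eq_sym (negPf (erev_neq G e)). Qed.

Lemma bar_eq e f : (bar e == f) = (e == bar f).
Proof. by apply/eqP/eqP => [<-|->]; rewrite erevK. Qed.

Lemma mv_nil f : mv [::] f = [:: f].
Proof. by rewrite /mv /= bar_neq. Qed.

Lemma mv_rcons s x f :
  mv (rcons s x) f = if x == bar f then s else rcons (rcons s x) f.
Proof.
by rewrite /mv last_rcons size_rcons /= -cats1 take_size_cat.
Qed.

Lemma mv_cons x s f : s != [::] -> mv (x :: s) f = x :: mv s f.
Proof.
case/lastP: s => // s y _; rewrite -rcons_cons !mv_rcons.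
by case: ifP.
Qed.

(** The two moves act at opposite ends of the walk; they can only interfere when it has at most one
    edge. This is what makes a change of root an isomorphism of trees. *)
Lemma lmv_mv e s f : lmv e (mv s f) = mv (lmv e s) f.
Proof.
case: s => [|x s].
  rewrite mv_nil /= -[[:: e]]/(rcons [::] e) mv_rcons.
  by rewrite [f == _]eq_sym bar_eq; case: ifP.
have [->|s0] := eqVneq s [::].
  rewrite -[[:: x]]/(rcons [::] x) mv_rcons /=.
  case: (eqVneq x (bar f)) => [->|xf].
    case: (eqVneq (bar f) (bar e)) => [/(can_inj (erevK G))->|fe].
      by rewrite mv_nil.
    by rewrite -[[:: e; bar f]]/(rcons [:: e] (bar f)) mv_rcons eqxx.
  rewrite /=; case: ifP => [/eqP xe|_]; first by rewrite mv_nil.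
  by rewrite -[[:: e; x]]/(rcons [:: e] x) mv_rcons (negPf xf).
rewrite mv_cons//=; case: ifP => // _.
by rewrite !mv_cons.
Qed.

Lemma nbwalk_rconsE r s e : nbwalk G r (rcons s e) =
  [&& nbwalk G r s, src G e == walk_end r s & last e s != bar e].
Proof.
rewrite /walk_end; case: s => [|x s] /=; first by rewrite bar_neq !andbT.
rewrite rcons_path -andbA last_map; congr [&& _, _ & _].
by rewrite /nbstep [src G e == _]eq_sym.
Qed.

Lemma nbwalk_consE r e s : nbwalk G r (e :: s) =
  [&& src G e == r, nbwalk G (tgt G e) s & head e s != bar e].
Proof.
case: s => [|f s] /=; first by rewrite bar_neq.
rewrite /nbstep -!andbA; congr andb; rewrite [src G f == _]eq_sym; congr andb.
by rewrite andbC [in RHS]eq_sym bar_eq.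
Qed.

Lemma walk_end_rcons r s e : walk_end r (rcons s e) = tgt G e.
Proof. by rewrite /walk_end map_rcons last_rcons. Qed.

Lemma walk_end_cons r s e : walk_end r (e :: s) = walk_end (tgt G e) s.
Proof. by []. Qed.

Lemma nbwalk_mv r s f : nbwalk G r s -> src G f = walk_end r s ->
  nbwalk G r (mv s f).
Proof.
case/lastP: s => [|s x] hs hf; first by rewrite mv_nil /= hf eqxx.
rewrite mv_rcons; case: ifP => [_|xf].
  by move: hs; rewrite nbwalk_rconsE => /and3P[].
by rewrite nbwalk_rconsE hs hf eqxx last_rcons xf.
Qed.

Lemma walk_end_mv r s f : nbwalk G r s -> src G f = walk_end r s ->
  walk_end r (mv s f) = tgt G f.
Proof.
case/lastP: s => [|s x] hs hf; first by rewrite mv_nil.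
rewrite mv_rcons; case: ifP => [/eqP xf|xf]; last by rewrite walk_end_rcons.
move: hs; rewrite nbwalk_rconsE => /and3P[_ /eqP <- _].
by rewrite xf src_bar.
Qed.

(** If the first move cancels the last edge, the second must append it again rather than cancel one
    more; this is where non-backtracking enters. *)
Lemma mvK r s f : nbwalk G r s -> mv (mv s f) (bar f) = s.
Proof.
case/lastP: s => [|s x] hs.
  by rewrite mv_nil -[[:: f]]/(rcons [::] f) mv_rcons erevK eqxx.
rewrite mv_rcons; case: ifP => [/eqP xf|xf]; last by rewrite mv_rcons erevK eqxx.
move: hs; rewrite nbwalk_rconsE => /and3P[_ _].
by rewrite xf /mv => /negPf ->.
Qed.

Lemma nbwalk_lmv e s : nbwalk G (tgt G e) s -> nbwalk G (src G e) (lmv e s).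
Proof.
case: s => [|x s] hs; first by rewrite /= eqxx.
rewrite [lmv _ _]/=; case: ifP => [/eqP xe|xe].
  by move: hs; rewrite nbwalk_consE xe tgt_bar => /and3P[].
by rewrite nbwalk_consE eqxx hs /= xe.
Qed.

Lemma walk_end_lmv e s : walk_end (src G e) (lmv e s) = walk_end (tgt G e) s.
Proof.
case: s => [|x s] //=; case: ifP => [/eqP ->|_] //.
by rewrite walk_end_cons tgt_bar.
Qed.

Lemma lmvK e s : nbwalk G (tgt G e) s -> lmv (bar e) (lmv e s) = s.
Proof.
case: s => [|x s]; first by rewrite /= erevK eqxx.
rewrite nbwalk_consE [lmv e _]/= => /and3P[_ _ hs].
case: ifP => [/eqP xe|xe]; last by rewrite /= erevK eqxx.
by case: s hs => [|y s] /=; rewrite xe // => /negPf ->.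
Qed.

End WalkMoves.

(** * The Jacobi operator of the cover as a sum over edges of [G] *)

Section CoverJacobi.
Context {R : realType} {V E : finType} (G : graph R V E).
Implicit Types (e f : E) (u v r : V).

Local Notation bar := (erev G).
Local Notation A r := (jacobi (universal_cover G r)).

Lemma cover_vertE r (w : cvert G r) : cover_vert w = walk_end G r (val w).
Proof. by []. Qed.

(** Meaningful when [f] starts at the image of [w]; the default [w] only makes it total, so that it
    can appear under sums over [E]. *)
Definition nbr r (w : cvert G r) f : cvert G r := insubd w (mv G (val w) f).

Lemma val_nbr r (w : cvert G r) f : src G f = cover_vert w ->
  val (nbr w f) = mv G (val w) f.
Proof.
by move=> hf; rewrite insubdK//; exact: nbwalk_mv (valP w) hf.
Qed.

Lemma cover_nbr r (w : cvert G r) f : src G f = cover_vert w ->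
  cover_vert (nbr w f) = tgt G f.
Proof.
by move=> hf; rewrite cover_vertE val_nbr// (walk_end_mv (valP w)).
Qed.

(** The covering map is a bijection from the edges ending at [w] to the edges of [G] ending at its
    image. *)
Lemma jacobi_coverE r (k : cvert G r -> R[i]) w :
  A r k w = (pot G (cover_vert w))%:C * k w +
    \sum_(e | tgt G e == cover_vert w) wt G e * k (nbr w (bar e)).
Proof.
rewrite /jacobi; congr (_ + _).
have tgtE x : tgt (universal_cover G r) x = w -> tgt G (cover_edge x) = cover_vert w.
  case: x => [[[s e] []] p] /= <-; rewrite /cover_edge /cover_vert /=.
    by rewrite map_rcons last_rcons.
  by move: (p); rewrite nbwalk_rconsE tgt_bar => /and3P[_ /eqP].
have srcE x : tgt (universal_cover G r) x = w ->
    src (universal_cover G r) x = nbr w (bar (cover_edge x)).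
  move=> xw; apply: val_inj; rewrite val_nbr ?src_bar ?tgtE//.
  case: x xw => [[[s e] []] p] /= <-; rewrite /cover_edge /=.
    by rewrite mv_rcons erevK eqxx.
  by move: (p); rewrite nbwalk_rconsE /mv erevK => /and3P[_ _ /negPf->].
transitivity (\sum_(e \in [set e | tgt G e = cover_vert w])
    wt G e * k (nbr w (bar e))); last first.
  rewrite (bigfs _ (index_enum_uniq E)) => [|e _]; last by rewrite mem_index_enum.
  by congr (\sum_(e \in _) _); apply/seteqP; split=> e /= /eqP.
rewrite [RHS](@reindex_fsbig _ _ _ _ _ (@cover_edge _ _ _ G r)
  [set x | tgt (universal_cover G r) x = w]).
  by apply: eq_fsbigr => x; rewrite inE => xw; rewrite (srcE _ xw).
split.
- by move=> x /= /tgtE.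
(* By [srcE], equal images and equal targets give equal sources; edges of opposite directions are
   excluded by the lengths of the walks. *)
- move=> x y; rewrite !inE => xw yw exy.
  have := congr1 val (etrans (srcE _ xw) (etrans _ (esym (srcE _ yw)))).
  rewrite exy => /(_ erefl).
  move: xw yw exy => /= /(congr1 val) + /(congr1 val).
  case: x y => [[[s e] []] p] [[[t f] []] q] /= <-; rewrite /cover_edge /=.
  + by move=> + ef st; move=> _; apply: val_inj; rewrite /= ef st.
  + move=> /(congr1 size) h1 _ /(congr1 size) h2; exfalso.
    by move: h1 h2; rewrite !size_rcons; lia.
  + move=> /(congr1 size) h1 _ /(congr1 size) h2; exfalso.
    by move: h1 h2; rewrite !size_rcons; lia.
  + by move=> ts /(can_inj (erevK G)) ef _; apply: val_inj; rewrite /= ef ts.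
- move=> e /= te.
  (* The edge over [e] is either the last step of [w] or the return from the extension of [w] by
     [bar e]. The default [bar e] puts the empty walk in the second case. *)
  case: (eqVneq (last (bar e) (val w)) e) => we.
    have : val w != [::].
      by apply/eqP => w0; move: we; rewrite w0 /= => /eqP; rewrite eq_sym bar_neq.
    have := valP w; move: we; move ws : (val w) => t.
    case/lastP: t ws => // s x ws; rewrite last_rcons => xe p _; subst x.
    exists (exist (fun x => is_true (nbwalk G r (rcons x.1.1 x.1.2)))
      (s, e, true) p) => //=.
    by apply: val_inj; rewrite /= ws.
  have p : nbwalk G r (rcons (val w) (bar e)).
    by rewrite nbwalk_rconsE (valP w) src_bar te cover_vertE eqxx erevK.
  exists (exist (fun x => is_true (nbwalk G r (rcons x.1.1 x.1.2)))
    (val w, bar e, false) p).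
    by apply: val_inj.
  by rewrite /cover_edge /= erevK.
Qed.

End CoverJacobi.

(** * Bounded operators on l^2 *)

Section BoundedOperators.
Context {R : realType} {X : choiceType}.
Implicit Types (h k : X -> R[i]) (S T : (X -> R[i]) -> (X -> R[i])).

(** Quantifying over all functions instead of those in l^2 spares side conditions in sums; [C]
    bounds squared norms. *)
Definition ell2_bounded S : Prop :=
  exists C : R, 0 <= C /\ forall h, (normsq (S h) <= C%:E * normsq h)%E.

Lemma ell2_boundedD S T : ell2_bounded S -> ell2_bounded T ->
  ell2_bounded (fun h x => S h x + T h x).
Proof.
move=> [C [C0 hC]] [D [D0 hD]]; exists (2 * C + 2 * D); split.
  by rewrite addr_ge0// mulr_ge0.
move=> h; apply: (le_trans (normsqD_le _ _)).
rewrite [leRHS]muleC (EFinD (2 * C)) ge0_muleDr ?lee_fin ?mulr_ge0//.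
rewrite !(EFinM 2) ![(normsq h * _)%E]muleC -!muleA.
by apply: leeD; apply: lee_wpmul2l; rewrite ?lee_fin.
Qed.

Lemma ell2_bounded0 : ell2_bounded (fun _ _ => 0).
Proof.
exists 0; split=> // h; rewrite mul0e.
by rewrite /normsq esum1// => x _; rewrite Normc.normc0 expr0n.
Qed.

Lemma ell2_bounded_sum (I : Type) (r : seq I) (S : I -> (X -> R[i]) -> (X -> R[i])) :
  (forall i, ell2_bounded (S i)) ->
  ell2_bounded (fun h x => \sum_(i <- r) S i h x).
Proof.
move=> hS; elim: r => [|i r IH].
  have -> : (fun h x => \sum_(i <- [::]) S i h x) = (fun _ _ => 0)
      :> ((X -> R[i]) -> X -> R[i]).
    by apply/funext => h; apply/funext => x; rewrite big_nil.
  exact: ell2_bounded0.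
have -> : (fun h x => \sum_(j <- i :: r) S j h x) =
    (fun h x => S i h x + \sum_(j <- r) S j h x) :> ((X -> R[i]) -> X -> R[i]).
  by apply/funext => h; apply/funext => x; rewrite big_cons.
exact: ell2_boundedD.
Qed.

(** The building block for the cover: its Jacobi operator is the sum of one such weighted partial
    injection for the potential and one for each edge of [G]. *)
Lemma ell2_bounded_comp_inj (D : X -> bool) (p : X -> X) (c : X -> R[i]) (b : R) :
  (forall x, Normc.normc (c x) <= b) ->
  {in D &, injective p} ->
  ell2_bounded (fun h x => if D x then c x * h (p x) else 0).
Proof.
move=> cb pinj.
have n0 (z : R[i]) : 0 <= Normc.normc z by case: z => *; rewrite sqrtr_ge0.
exists (b ^+ 2); split; first exact: sqr_ge0.
move=> h; rewrite /normsq.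
rewrite -[leRHS]esumZ ?sqr_ge0//; last by move=> x; rewrite sqr_ge0.
pose F x := (b ^+ 2 * Normc.normc (h x) ^+ 2)%:E.
have F0 x : (0 <= F x)%E by rewrite lee_fin mulr_ge0 ?sqr_ge0.
apply: (@le_trans _ _ (\esum_(x in [set x | D x]) F (p x))%E).
  rewrite [leRHS]esum_mkcond; apply: le_esum => x _.
  have -> : (x \in [set x | D x]) = D x.
    by apply/idP/idP => [|Dx]; rewrite inE.
  case: ifP => Dx; last by rewrite Normc.normc0 expr0n.
  rewrite lee_fin Normc.normcM exprMn ler_wpM2r ?sqr_ge0//.
  by rewrite lerXn2r ?nnegrE ?(le_trans (n0 _) (cb x)).
rewrite -esum_image; last first.
  by move=> x y; rewrite !inE => Dx Dy; exact: pinj.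
rewrite [leLHS]esum_mkcond; apply: le_esum => x _.
by case: ifP => // _; exact: F0.
Qed.

Lemma ell2_bounded_op_bound S : ell2_bounded S -> exists M, op_bound S M.
Proof.
(* [op_bound] squares its constant, and C <= (C + 1)^2 avoids a square root. *)
move=> [C [C0 hC]]; exists (C + 1); split; first by rewrite addr_ge0.
move=> h _; apply: (le_trans (hC h)); apply: lee_wpmul2r; first exact: normsq_ge0.
by rewrite lee_fin expr2; nra.
Qed.

Lemma op_bound_ell2 S M h : op_bound S M -> ell2 h -> ell2 (S h).
Proof.
move=> [M0 hM] hh; apply: le_lt_trans (hM h hh) _.
by rewrite lte_mul_pinfty ?lee_fin ?sqr_ge0.
Qed.

Lemma sqn_delta (x : X) : sqn (delta x : X -> R[i]) = 1.
Proof.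
rewrite /sqn /normsq (esumID [set x]); last by move=> *; rewrite lee_fin sqr_ge0.
rewrite setTI setTI esum_set1 ?lee_fin ?sqr_ge0// esum1 ?adde0.
  by rewrite /delta eqxx Normc.normc1 expr1n.
by move=> y /= /eqP xy; rewrite /delta (negPf xy) Normc.normc0 expr0n.
Qed.

Lemma inner_delta (x : X) k : inner (delta x) k = k x.
Proof.
have dE : delta x = restr (pred1 x) (delta x : X -> R[i]).
  by apply/funext => y; rewrite /restr /delta /=; case: (y == x).
rewrite dE inner_restr -dE.
have -> : restr (pred1 x) k = (fun y => k x * delta x y + 0).
  by apply/funext => y; rewrite /restr /delta /= addr0; case: eqP => [->|_];
    rewrite ?mulr1 ?mulr0.
rewrite inner_linr; [|exact: ell2_delta..|exact: ell20].
by rewrite inner0r addr0 inner_self sqn_delta mulr1.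
Qed.

End BoundedOperators.

(** * Boundedness of the Jacobi operator of the cover *)

Section CoverBounded.
Context {R : realType} {V E : finType} (G : graph R V E) (r : V).

Lemma cover_jacobi_bounded :
  exists M, op_bound (jacobi (universal_cover G r)) M.
Proof.
apply: ell2_bounded_op_bound.
have -> : jacobi (universal_cover G r) = (fun h w =>
   (if xpredT w then (pot G (cover_vert w))%:C * h w else 0) +
   \sum_(e <- index_enum E) (fun e h w =>
     if tgt G e == cover_vert w then wt G e * h (nbr w (erev G e)) else 0) e h w).
  apply/funext => h; apply/funext => w; rewrite jacobi_coverE.
  by congr (_ + _); rewrite big_mkcond.
apply: ell2_boundedD.
  apply: (@ell2_bounded_comp_inj _ _ xpredT id (fun w => (pot G (cover_vert w))%:C)
    (\sum_v `|pot G v|)) => //.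
  move=> w; rewrite /= expr0n addr0 sqrtr_sqr (bigD1 (cover_vert w))//=.
  by rewrite lerDl sumr_ge0.
apply: ell2_bounded_sum => e.
apply: (@ell2_bounded_comp_inj _ _ (fun w => tgt G e == cover_vert w)
   (fun w => nbr w (erev G e)) (fun=> wt G e) (Normc.normc (wt G e))) => //.
(* A vertex is recovered from its neighbour by the step back, [mvK]. *)
move=> w w'; rewrite -!topredE /= => /eqP hw /eqP hw' /(congr1 val).
rewrite !val_nbr ?src_bar// => /(congr1 (fun s => mv G s (erev G (erev G e)))).
by rewrite (mvK _ (valP w)) (mvK _ (valP w')); exact: val_inj.
Qed.

End CoverBounded.

(** * The functional calculus at the point [lambda] *)

Section SpectralProjection.
Context {R : realType} {X : choiceType}.
Variables (A : (X -> R[i]) -> (X -> R[i])) (M : R) (lambda : R).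
Variable Phi : (R -> R) -> (X -> R[i]) -> (X -> R[i]).
Hypothesis hPhi : borel_calculus A Phi.
Hypothesis hM : op_bound A M.

Definition eigenfunction (A : (X -> R[i]) -> (X -> R[i])) lambda (k : X -> R[i]) :=
  ell2 k /\ A k =1 (fun x => lambda%:C * k x).

(** [clamp] is a bounded substitute for the identity: it agrees with it on [-M, M], so that
    [Phi clamp] is [A], and since [L] exceeds |lambda| it takes the value [lambda] only at
    [lambda]. *)
Let L : R := Num.max M `|lambda| + 1.
Let clamp (t : R) : R := Num.max (- L) (Num.min t L).
Let ind (t : R) : R := \1_[set lambda] t.

Let L_gt : `|lambda| < L.
Proof. by rewrite /L ltr_pwDr// le_max lexx orbT. Qed.

Let L_ge0 : 0 < L. Proof. exact: le_lt_trans (normr_ge0 _) L_gt. Qed.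

Let clamp_le t : `|clamp t| <= L.
Proof.
rewrite ler_norml /clamp le_max lexx ge_max ge_min lexx orbT andbT /=.
by have := L_ge0; lra.
Qed.

Let clamp_id t : `|t| <= M -> clamp t = t.
Proof.
move=> tM; have : `|t| <= L by rewrite (le_trans tM)// /L ler_wpDr// le_max lexx.
rewrite ler_norml => /andP[h1 h2]; rewrite /clamp.
by case: (lerP t L) => tL; case: (lerP (- L) _) => ?; lra.
Qed.

Let clamp_eq t : clamp t = lambda -> t = lambda.
Proof.
have := L_gt; rewrite ltr_norml => /andP[h1 h2].
by rewrite /clamp; case: (lerP t L) => tL; case: (lerP (- L) _) => ? ?; lra.
Qed.

Let clamp_borel : bounded_borel clamp.
Proof.
split; last by exists L.
have m1 : measurable_fun [set: R] (fun t : R => Num.min t L).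
  by apply: (@measurable_minr _ _ _ _ id (fun=> L)).
have m0 : measurable_fun [set: R] (fun _ : R => - L) by [].
exact: (measurable_maxr m0 m1).
Qed.

Let ind_borel : bounded_borel ind.
Proof.
split; last first.
  by exists 1 => t; rewrite /ind indicE; case: (_ \in _); rewrite ?normr1 ?normr0.
exact: measurable_indic.
Qed.

Let cst_borel (c : R) : bounded_borel (fun=> c).
Proof. by split=> //; exists `|c|. Qed.

Let mul_borel (f g : R -> R) : bounded_borel f -> bounded_borel g ->
  bounded_borel (fun t => f t * g t).
Proof.
move=> [mf [Mf bf]] [mg [Mg bg]]; split; first exact: measurable_funM.
by exists (Mf * Mg) => t; rewrite normrM ler_pM.
Qed.

Let lin_borel c (f g : R -> R) : bounded_borel f -> bounded_borel g ->
  bounded_borel (fun t => c * f t + g t).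
Proof.
move=> bf [mg [Mg bg]].
have [mf [Mf bf']] := mul_borel (cst_borel c) bf.
split; first exact: measurable_funD.
by exists (Mf + Mg) => t; rewrite (le_trans (ler_normD _ _))// lerD.
Qed.

Let Phi_ell2 f h : bounded_borel f -> ell2 h -> ell2 (Phi f h).
Proof.
move=> bf hh; have [mf [C hC]] := bf.
exact: op_bound_ell2 (bc_bound hPhi bf hC) hh.
Qed.

Let PhiA h : ell2 h -> Phi clamp h = A h.
Proof.
by move=> hh; apply/funext; exact: (bc_id hPhi clamp_borel hM clamp_id hh).
Qed.

Lemma calculus_selfadjoint h k : ell2 h -> ell2 k ->
  inner (A h) k = inner h (A k).
Proof. by move=> hh hk; rewrite -!PhiA// (bc_sa hPhi clamp_borel). Qed.

Lemma spectral_projection_eigen h : ell2 h ->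
  eigenfunction A lambda (Phi (\1_[set lambda]) h).
Proof.
move=> hh; have lP : ell2 (Phi ind h) by exact: Phi_ell2.
split=> // x; rewrite -[LHS](congr1 (@^~ x) (PhiA lP)).
rewrite -(bc_mul hPhi clamp_borel ind_borel hh).
(* Both sides are [lambda * ind t]; the right-hand side has the shape [c * f + g] required by
   [bc_lin]. *)
have -> : (fun t => clamp t * ind t) = (fun t => (lambda - 1) * ind t + ind t).
  apply/funext => t; rewrite /ind indicE; case: (boolP (t \in _)).
    rewrite inE => ->; rewrite !mulr1 subrK /clamp.
    have := L_gt; rewrite ltr_norml => /andP[h1 h2].
    by case: (lerP lambda L) => ?; case: (lerP (- L) _) => ?; lra.
  by rewrite !mulr0 addr0.
rewrite (bc_lin hPhi (lambda - 1) ind_borel ind_borel hh).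
by rewrite rmorphB rmorph1 mulrBl mul1r subrK.
Qed.

(* [q] peaks at [lambda], so that [Phi (q ^+ m)] tends to the spectral projection,
   while [Phi q] fixes the eigenfunctions because [Phi (clamp - lambda)] kills
   them. *)
Let q (t : R) : R := - (L *+ 2) ^- 2 *
   ((- lambda * 1 + clamp t) * (- lambda * 1 + clamp t)) + 1.

Let q_borel : bounded_borel q.
Proof.
have b : bounded_borel (fun t => - lambda * 1 + clamp t).
  exact: (lin_borel (- lambda) (cst_borel 1) clamp_borel).
exact: (lin_borel _ (mul_borel b b) (cst_borel 1)).
Qed.

(** Both [clamp t] and [lambda] lie in [-L, L], so their distance is at most the normalising
    constant [L *+ 2]. *)
Let q_ge0 t : 0 <= q t <= 1.
Proof.
have L2 : 0 < (L *+ 2) ^+ 2 by rewrite exprn_gt0// mulrn_wgt0.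
rewrite /q mulNr addrC subr_ge0 lerBlDr lerDl.
rewrite [(_ ^- 2) * _]mulrC -expr2; apply/andP; split; last first.
  by rewrite mulr_ge0 ?invr_ge0 ?sqr_ge0.
rewrite ler_pdivrMr// mul1r -[leLHS]real_normK ?num_real// lerXn2r ?nnegrE//.
  by rewrite mulrn_wge0// ltW.
rewrite (le_trans (ler_normD _ _))// mulr2n lerD// mulr1 normrN.
exact: ltW.
Qed.

Let q_lt1 t : t != lambda -> q t < 1.
Proof.
have L2 : 0 < (L *+ 2) ^+ 2 by rewrite exprn_gt0// mulrn_wgt0.
move=> tl; rewrite /q mulNr addrC ltrBlDr ltrDl mulr_gt0 ?invr_gt0//.
rewrite -expr2 lt_def sqr_ge0 andbT sqrf_eq0 mulr1 addrC subr_eq0.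
by apply: contra tl => /eqP/clamp_eq ->.
Qed.

Let q_lambda : q lambda = 1.
Proof.
rewrite /q (_ : clamp lambda = lambda) ?mulr1 ?addNr ?mulr0 ?add0r//.
have := L_gt; rewrite ltr_norml => /andP[h1 h2]; rewrite /clamp.
by case: (lerP lambda L) => ?; case: (lerP (- L) _) => ?; lra.
Qed.

Let qX_cvg t : (fun m => q t ^+ m) @ \oo --> ind t.
Proof.
rewrite /ind indicE; case: (eqVneq t lambda) => [->|tl].
  rewrite q_lambda mem_set//=; under eq_fun do rewrite expr1n.
  exact: cvg_cst.
rewrite memNset; last by move=> /= tl'; move/eqP: tl.
apply: cvg_expr; rewrite ger0_norm; first exact: q_lt1.
by case/andP: (q_ge0 t).
Qed.

Let qX_borel m : bounded_borel (fun t => q t ^+ m).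
Proof.
elim: m => [|m IH]; first exact: (cst_borel 1).
by under eq_fun do rewrite exprS; exact: mul_borel.
Qed.

Let Phi_qX m k : eigenfunction A lambda k -> Phi (fun t => q t ^+ m) k = k.
Proof.
move=> [lk Ak].
have P1 h : ell2 h -> Phi (fun=> 1) h = h by move=> hh; apply/funext/(bc_one hPhi hh).
have b : bounded_borel (fun t => - lambda * 1 + clamp t).
  exact: (lin_borel (- lambda) (cst_borel 1) clamp_borel).
have Pb : Phi (fun t => - lambda * 1 + clamp t) k = fun=> 0.
  apply/funext => x; rewrite (bc_lin hPhi (- lambda) (cst_borel 1) clamp_borel lk).
  by rewrite P1// PhiA// Ak rmorphN mulNr addNr.
have P0 : Phi (fun t => - lambda * 1 + clamp t) (fun=> 0) = fun=> 0.
  apply/funext => x.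
  (* Linearity at -1 * 0 + 0 gives F 0 = - F 0 + F 0, that is, F 0 = 0. *)
  have := bc_op hPhi b (-1) (ell20 : ell2 (fun _ : X => 0 : R[i])) ell20.
  have -> : (fun _ : X => -1 * 0 + 0 : R[i]) = (fun=> 0).
    by apply/funext => y; rewrite mulr0 addr0.
  by move=> ->; rewrite mulN1r addNr.
have Pq : Phi q k = k.
  apply/funext => x; rewrite /q.
  rewrite (bc_lin hPhi _ (mul_borel b b) (cst_borel 1) lk) (bc_mul hPhi b b lk).
  by rewrite Pb P0 mulr0 add0r P1.
elim: m => [|m IH]; first by under eq_fun do rewrite expr0; exact: P1.
have -> : (fun t => q t ^+ m.+1) = (fun t => q t * q t ^+ m).
  by apply/funext => t; rewrite exprS.
by apply/funext => x; rewrite (bc_mul hPhi q_borel (qX_borel m) lk) IH Pq.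
Qed.

Lemma spectral_projection_id k : eigenfunction A lambda k ->
  Phi (\1_[set lambda]) k = k.
Proof.
move=> hk; have [lk _] := hk.
have := @bc_cvg _ _ _ _ hPhi (fun m t => q t ^+ m) ind 1 k
  qX_borel ind_borel _ qX_cvg lk.
have -> : (fun m => normsq (fun x => Phi (fun t => q t ^+ m) k x - Phi ind k x))
   = fun=> normsq (fun x => k x - Phi ind k x).
  by apply/funext => m; rewrite Phi_qX.
move=> h.
(* The sequence that tends to 0 is constant, because each [Phi (q ^+ m)] fixes [k]. *)
have z : normsq (fun x => k x - Phi ind k x) = 0%E.
  rewrite -(cvg_lim (@ereal_hausdorff R) (h _)) ?lim_cst//.
  move=> m t; have /andP[q0 q1] := q_ge0 t.
  by rewrite ger0_norm ?exprn_ge0// exprn_ile1.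
apply/funext => x; apply/esym/eqP; rewrite -subr_eq0; apply/eqP.
apply: (@sqn_eq0 _ _ (fun x => k x - Phi ind k x)); last by rewrite /sqn z.
by rewrite /ell2 z.
Qed.

Lemma spectral_projection_inner h k : ell2 h -> eigenfunction A lambda k ->
  inner (Phi (\1_[set lambda]) h) k = inner h k.
Proof.
move=> hh hk; have [lk _] := hk.
by rewrite (bc_sa hPhi ind_borel hh lk) -/ind spectral_projection_id.
Qed.

End SpectralProjection.

(** * Independence of the root of the cover *)

Section Reroot.
Context {R : realType} {V E : finType} (G : graph R V E) (lambda : R) (d : V -> R).
Implicit Types (e f : E) (u v r : V).

Local Notation bar := (erev G).
Local Notation A r := (jacobi (universal_cover G r)).
Local Notation K r := (eigenfunction (jacobi (universal_cover G r)) lambda).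

Lemma nbwalk_lmv_bar e s : nbwalk G (src G e) s -> nbwalk G (tgt G e) (lmv G (bar e) s).
Proof. by have := @nbwalk_lmv _ _ _ G (bar e) s; rewrite tgt_bar src_bar. Qed.

Definition reroot e (w : cvert G (tgt G e)) : cvert G (src G e) :=
  exist _ (lmv G e (val w)) (nbwalk_lmv (valP w)).

Definition unreroot e (w : cvert G (src G e)) : cvert G (tgt G e) :=
  exist _ (lmv G (bar e) (val w)) (nbwalk_lmv_bar (valP w)).

Lemma rerootK e : cancel (@reroot e) (@unreroot e).
Proof. by move=> w; apply: val_inj => /=; rewrite lmvK ?(valP w). Qed.

Lemma unrerootK e : cancel (@unreroot e) (@reroot e).
Proof.
move=> w; apply: val_inj => /=.
by rewrite -{1}(erevK G e) lmvK// tgt_bar (valP w).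
Qed.

Lemma cover_reroot e (w : cvert G (tgt G e)) : cover_vert (reroot w) = cover_vert w.
Proof. exact: walk_end_lmv. Qed.

Lemma nbr_reroot e (w : cvert G (tgt G e)) f : src G f = cover_vert w ->
  nbr (reroot w) f = reroot (nbr w f).
Proof.
move=> hf; apply: val_inj; rewrite val_nbr ?cover_reroot//= val_nbr//.
by rewrite lmv_mv.
Qed.

Lemma jacobi_reroot e (k : cvert G (src G e) -> R[i]) :
  A (tgt G e) (k \o @reroot e) = A (src G e) k \o @reroot e.
Proof.
apply/funext => w /=; rewrite !jacobi_coverE cover_reroot; congr (_ + _).
by apply: eq_bigr => f /eqP hf; rewrite nbr_reroot ?src_bar.
Qed.

Lemma reroot_bij e :
  set_bij [set: cvert G (tgt G e)] [set: cvert G (src G e)] (@reroot e).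
Proof.
split=> //; first by move=> x y _ _; exact: (can_inj (@rerootK e)).
by move=> y _; exists (unreroot y); rewrite // unrerootK.
Qed.

Lemma normsq_reroot e (k : cvert G (src G e) -> R[i]) :
  normsq (k \o @reroot e) = normsq k.
Proof. by rewrite /normsq [RHS](reindex_esum _ _ _ _ (reroot_bij e)). Qed.

Lemma sqn_reroot e (k : cvert G (src G e) -> R[i]) :
  sqn (k \o @reroot e) = sqn k.
Proof. by rewrite /sqn normsq_reroot. Qed.

Lemma inner_reroot e (h k : cvert G (src G e) -> R[i]) :
  inner (h \o @reroot e) (k \o @reroot e) = inner h k.
Proof.
rewrite /inner /csum /rsum.
by congr (Complex (fine _ - fine _) (fine _ - fine _));
  rewrite [RHS](reindex_esum _ _ _ _ (reroot_bij e)).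
Qed.

Lemma ell2_reroot e (k : cvert G (src G e) -> R[i]) :
  ell2 k -> ell2 (k \o @reroot e).
Proof. by rewrite /ell2 normsq_reroot. Qed.

Lemma unreroot_comp e (k : cvert G (tgt G e) -> R[i]) :
  (k \o @unreroot e) \o @reroot e = k.
Proof. by apply/funext => x /=; rewrite rerootK. Qed.

Lemma ell2_unreroot e (k : cvert G (tgt G e) -> R[i]) :
  ell2 k -> ell2 (k \o @unreroot e).
Proof. by rewrite -{1}(unreroot_comp k) /ell2 normsq_reroot. Qed.

Lemma eigen_reroot e (k : cvert G (src G e) -> R[i]) :
  K (src G e) k -> K (tgt G e) (k \o @reroot e).
Proof.
move=> [lk Ak]; split; first exact: ell2_reroot.
by move=> x; rewrite jacobi_reroot /= Ak.
Qed.

Lemma eigen_unreroot e (k : cvert G (tgt G e) -> R[i]) :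
  K (tgt G e) k -> K (src G e) (k \o @unreroot e).
Proof.
move=> [lk Ak]; split; first exact: ell2_unreroot.
move=> x; rewrite -[x in LHS](unrerootK x).
have := jacobi_reroot (k \o @unreroot e).
rewrite unreroot_comp => /(congr1 (@^~ (unreroot x))) /= <-.
by rewrite Ak.
Qed.

(** Characterises the projection of [delta w] to the eigenspace without mentioning the functional
    calculus, so that it can be transported to another root. *)
Definition reproducing r (w : cvert G r) (g : cvert G r -> R[i]) : Prop :=
  K r g /\ forall k, K r k -> inner g k = k w.

Lemma reproducing_reroot e (w : cvert G (tgt G e)) g :
  reproducing (reroot w) g -> reproducing w (g \o @reroot e).
Proof.
move=> [Kg hg]; split; first exact: eigen_reroot.
move=> k Kk; rewrite -{1}(unreroot_comp k) inner_reroot hg.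
  by rewrite /= rerootK.
exact: eigen_unreroot.
Qed.

Lemma eigenP r (c : R[i]) h k : K r h -> K r k -> K r (fun x => c * h x + k x).
Proof.
move=> [lh Ah] [lk Ak]; split; first exact: ell2P.
move=> x; rewrite mulrDr -Ak mulrCA -Ah !jacobi_coverE !mulrDr addrACA.
rewrite mulr_sumr -big_split /=; congr (_ + _); first by rewrite mulrCA.
by apply: eq_bigr => f _; rewrite mulrDr mulrCA.
Qed.

Lemma eigen0 r : K r (fun=> 0).
Proof.
split; first exact: ell20.
move=> x; rewrite jacobi_coverE !mulr0 add0r big1// => f _; rewrite mulr0 //.
Qed.

Lemma eigen_ext r h k : h =1 k -> K r h -> K r k.
Proof. by move=> /funext ->. Qed.

Lemma eigen_sum r (I : Type) (s : seq I) (P : pred I) (c : I -> R[i])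
    (F : I -> cvert G r -> R[i]) :
  (forall i, P i -> K r (F i)) -> K r (fun x => \sum_(i <- s | P i) c i * F i x).
Proof.
move=> hF; elim: s => [|i s IH].
  by apply: eigen_ext (@eigen0 r) => x; rewrite big_nil.
case Pi: (P i).
  by apply: eigen_ext (eigenP (c i) (hF i Pi) IH) => x; rewrite big_cons Pi.
by apply: eigen_ext IH => x; rewrite big_cons Pi.
Qed.

Lemma reproducing_unique r (w : cvert G r) g g' :
  reproducing w g -> reproducing w g' -> g = g'.
Proof.
move=> [Kg hg] [Kg' hg'].
have Kh : K r (fun x => -1 * g' x + g x) by exact: eigenP.
have h0 : sqn (fun x => -1 * g' x + g x) = 0.
  apply: (@complexI R); rewrite -inner_self inner_linl;
    [|exact: proj1 Kh|exact: proj1 Kg'|exact: proj1 Kg].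
  have aux (z : R[i]) : conjc (-1) * z + z = 0.
    by rewrite conjcN conjc1 mulN1r addNr.
  by rewrite hg// hg'//; exact: aux.
apply/funext => x; have := sqn_eq0 (proj1 Kh) h0 x.
by rewrite mulN1r addrC => /eqP; rewrite subr_eq0 => /eqP.
Qed.

(** All that the local arguments need to know about the spectral measures: symmetry of the operator,
    and reproducing vectors whose diagonal value depends only on the image in [G]. *)
Definition spectral_root r : Prop :=
  (forall h k, ell2 h -> ell2 k -> inner (A r h) k = inner h (A r k)) /\
  forall w : cvert G r, exists g, reproducing w g /\ g w = (d (cover_vert w))%:C.

Lemma spectral_root_reroot e : spectral_root (src G e) -> spectral_root (tgt G e).
Proof.
move=> [sa gam]; split.
  move=> h k lh lk; rewrite -(unreroot_comp h) -(unreroot_comp k) !jacobi_reroot.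
  by rewrite !inner_reroot; apply: sa; exact: ell2_unreroot.
move=> w; have [g [hg gw]] := gam (reroot w).
exists (g \o @reroot e); split; first exact: reproducing_reroot.
by rewrite /= gw cover_reroot.
Qed.

(** The spectral measures are given at one root, while the local arguments take place around the
    root and so need every vertex in that role. The root is moved along a path of [G]. *)
Lemma spectral_root_connected r v :
  connected_graph G -> spectral_root r -> spectral_root v.
Proof.
move=> /(_ r v) /connectP[p]; elim: p r => [|x p IH] r /= => [_ -> //|].
move=> /andP[/existsP[e /andP[/eqP <- /eqP <-]] hp] hv hr.
exact: (IH _ hp hv (spectral_root_reroot hr)).
Qed.

End Reroot.

(** * From the spectral measures to the reproducing vectors *)

Section SpectralMeasureRoot.
Context {R : realType} {V E : finType} (G : graph R V E) (lambda : R) (r : V).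
Variable mu : V -> {measure set R -> \bar R}.
Hypothesis hG : connected_graph G.
Hypothesis hmu : spectral_measures G r mu.

(** A path of [G] is lifted with [nbr], which cancels backtracking steps, so the path itself may
    backtrack. *)
Lemma cover_vert_surj u : exists w : cvert G r, cover_vert w = u.
Proof.
have step : forall p x (w : cvert G r), cover_vert w = x ->
    path (fun x y => [exists e, (src G e == x) && (tgt G e == y)]) x p ->
    u = last x p -> exists w : cvert G r, cover_vert w = u.
  elim=> [|y p IH] x w hw /= => [_ ->|]; first by exists w.
  move=> /andP[/existsP[e /andP[/eqP ex /eqP ey]] hp] hu.
  by apply: (IH y (nbr w e)) => //; rewrite cover_nbr// hw.
have /connectP[p hp hu] := hG r u.
exact: (step p r (exist _ [::] isT) erefl hp hu).
Qed.

(* [Rintegral] would turn an infinite total mass into the junk value 0, against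
   the norm 1 of [delta w]. *)
Lemma spectral_measure_fin u : (mu u [set lambda] \is a fin_num)%E.
Proof.
have [w hw] := cover_vert_surj u; case: hmu => Phi [hPhi /(_ u w hw)] h.
have b1 : bounded_borel (fun _ : R => 1 : R).
  by split=> //; exists 1 => _; rewrite normr1.
have := h _ b1; rewrite (_ : Phi _ _ = delta w); last first.
  by apply/funext => x; rewrite (bc_one hPhi)//; exact: ell2_delta.
rewrite inner_self sqn_delta Rintegral_cst// mul1r => /complexI fT.
have T : (mu u [set: R] < +oo)%E.
  by rewrite ltey; apply/eqP => Too; move: fT; rewrite Too /= => /eqP; rewrite oner_eq0.
rewrite ge0_fin_numE//; apply: le_lt_trans T.
by apply: le_measure => //; rewrite inE.
Qed.

(** The spectral projection of [delta w] is the reproducing vector at [w], and its diagonal entry is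
    the point mass at [lambda]. *)
Lemma spectral_measures_root :
  spectral_root G lambda (fun u => fine (mu u [set lambda])) r.
Proof.
case: (hmu) => Phi [hPhi hw]; have [M hM] := cover_jacobi_bounded G r; split.
  by move=> h k; exact: (calculus_selfadjoint lambda hPhi hM).
move=> w; exists (Phi (\1_[set lambda]) (delta w)); split; [split|].
- by apply: (spectral_projection_eigen lambda hPhi hM); exact: ell2_delta.
- move=> k Kk.
  rewrite (spectral_projection_inner (lambda := lambda) hPhi hM) ?inner_delta//.
  exact: ell2_delta.
- rewrite -inner_delta (hw (cover_vert w) w erefl).
    by rewrite /Rintegral integral_indic// setIT.
  split; first exact: measurable_indic.
  by exists 1 => t; rewrite indicE; case: (_ \in _); rewrite ?normr1 ?normr0.
Qed.

End SpectralMeasureRoot.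

(** * Pythagoras for restrictions to disjoint sets *)

Section RestrictedNorms.
Context {R : realType} {X : choiceType}.
Implicit Types (h : X -> R[i]) (B : X -> bool).

Let n0 (z : R[i]) : (0 <= (Normc.normc z ^+ 2)%:E)%E.
Proof. by rewrite lee_fin sqr_ge0. Qed.

Lemma normsq_restr1 h x : normsq (restr (pred1 x) h) = (Normc.normc (h x) ^+ 2)%:E.
Proof.
rewrite /normsq (esumID [set x]) => [|*]; last exact: n0.
rewrite setTI setTI esum_set1 ?n0// esum1 ?adde0; first by rewrite /restr /= eqxx.
by move=> y /= /eqP xy; rewrite /restr /= (negPf xy) Normc.normc0 expr0n.
Qed.

Lemma sqn_restrC B h : ell2 h ->
  sqn h = sqn (restr B h) + sqn (restr (fun x => ~~ B x) h).
Proof.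
move=> lh; apply: EFin_inj; rewrite EFinD -!normsqE ?ell2_restr//; try exact: ell2_restr.
rewrite /normsq -esumD => [|*|*]; [|exact: n0..].
apply: eq_esum => x _; rewrite /restr /negb; case: (B x).
  by rewrite Normc.normc0 expr0n adde0.
by rewrite Normc.normc0 expr0n add0e.
Qed.

Lemma normc_restr_gt0 B h x : ell2 h -> B x -> h x != 0 -> 0 < sqn (restr B h).
Proof.
move=> lh Bx hx; have := @normc_le_sqn _ _ (restr B h) x (ell2_restr B lh).
rewrite {1}/restr Bx; apply: lt_le_trans.
rewrite lt_def sqr_ge0 andbT; apply: contra hx => /eqP.
by move/normc_sq_eq0 => ->.
Qed.

Lemma sqn_partition (I : finType) (P : pred I) (B : I -> X -> bool) h x0 : ell2 h ->
  (forall i, P i -> ~~ B i x0) ->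
  (forall x, x != x0 -> exists2 i, P i & B i x) ->
  (forall i j x, B i x -> B j x -> i = j) ->
  sqn h = Normc.normc (h x0) ^+ 2 + \sum_(i | P i) sqn (restr (B i) h).
Proof.
move=> lh Bx0 Bex Buniq; apply: EFin_inj; rewrite EFinD -normsq_restr1.
rewrite -sumEFin -normsqE//.
rewrite [in RHS](eq_bigr (fun i => normsq (restr (B i) h))); last first.
  by move=> i _; rewrite -normsqE//; exact: ell2_restr.
rewrite /normsq -esum_sum => [|*]; last exact: n0.
rewrite -esumD => [|*|*]; [|exact: n0|by apply: sume_ge0 => *; exact: n0].
apply: eq_esum => x _.
have -> : restr (pred1 x0) h x = if x == x0 then h x else 0 by [].
case: (eqVneq x x0) => [->|xx0].
  rewrite big1 ?adde0// => i Pi.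
  by rewrite /restr (negPf (Bx0 i Pi)) Normc.normc0 expr0n.
rewrite Normc.normc0 expr0n add0e.
have [i Pi Bi] := Bex x xx0.
rewrite (bigD1 i)//= {1}/restr Bi big1 ?adde0// => j /andP[_ ji].
rewrite /restr; case: ifP => [Bj|_]; last by rewrite Normc.normc0 expr0n.
by move: ji; rewrite (Buniq _ _ _ Bi Bj) eqxx.
Qed.

End RestrictedNorms.

(** * Local relations between eigenfunctions, and the mass of branches *)

Section LocalRelations.
Context {R : realType} {V E : finType} (G : graph R V E) (lambda : R) (d : V -> R).
Hypothesis hroot : forall v, spectral_root G lambda d v.
Implicit Types (e f : E) (u v r : V).

Local Notation bar := (erev G).
Local Notation A r := (jacobi (universal_cover G r)).
Local Notation K r := (eigenfunction (jacobi (universal_cover G r)) lambda).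

(** The vector g_w of the header. *)
Definition kerproj r (w : cvert G r) : cvert G r -> R[i] :=
  sval (cid (proj2 (hroot r) w)).

Lemma kerprojP r (w : cvert G r) : reproducing lambda w (kerproj w).
Proof. by rewrite /kerproj; case: cid => g []. Qed.

Lemma kerproj_eigen r (w : cvert G r) : K r (kerproj w).
Proof. exact: (proj1 (kerprojP w)). Qed.

Lemma kerproj_ell2 r (w : cvert G r) : ell2 (kerproj w).
Proof. exact: (proj1 (kerproj_eigen w)). Qed.

Lemma kerproj_inner r (w : cvert G r) k : K r k -> inner (kerproj w) k = k w.
Proof. exact: (proj2 (kerprojP w)). Qed.

Lemma kerproj_self r (w : cvert G r) : kerproj w w = (d (cover_vert w))%:C.
Proof. by rewrite /kerproj; case: cid => g []. Qed.

Lemma sqn_kerproj r (w : cvert G r) : sqn (kerproj w) = d (cover_vert w).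
Proof.
apply: (@complexI R).
by rewrite -inner_self (kerproj_inner _ (kerproj_eigen w)) kerproj_self.
Qed.

Lemma eigen_eq0 r (w : cvert G r) k : d (cover_vert w) = 0 -> K r k -> k w = 0.
Proof.
move=> d0 Kk; rewrite -(kerproj_inner w Kk) (_ : kerproj w = fun=> 0) ?inner0l//.
by apply/funext; apply: sqn_eq0 (kerproj_ell2 w) _; rewrite sqn_kerproj.
Qed.

Lemma kerproj_reroot e (w : cvert G (tgt G e)) :
  kerproj w = kerproj (reroot w) \o @reroot _ _ _ G e.
Proof.
apply: reproducing_unique (kerprojP w) _; apply: reproducing_reroot; exact: kerprojP.
Qed.

(** The combination is itself an eigenfunction; applying the relation to it shows that its squared
    norm is 0. *)
Lemma kerproj_dependence r (I : finType) (w : I -> cvert G r) (c : I -> R[i]) :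
  (forall k, K r k -> \sum_i c i * k (w i) = 0) ->
  forall x, \sum_i conjc (c i) * kerproj (w i) x = 0.
Proof.
move=> ck; pose z x := \sum_i conjc (c i) * kerproj (w i) x.
have Kz : K r z by apply: eigen_sum => i _; exact: kerproj_eigen.
have z0 : inner z z = 0.
  rewrite {2}/z inner_sumr; last 2 first.
  - exact: (proj1 Kz).
  - by move=> i _; exact: kerproj_ell2.
  transitivity (conjc (\sum_i c i * z (w i))); last by rewrite ck// conjc0.
  rewrite conjc_sum; apply: eq_bigr => i _.
  by rewrite inner_conj kerproj_inner// conjcM.
apply: (sqn_eq0 (proj1 Kz)); apply: (@complexI R).
by rewrite -inner_self z0.
Qed.

(** [trace_bound] for the vectors [kerproj (w i)], whose dependence comes from a relation between
    the values of all eigenfunctions at the [w i]. *)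
Lemma kernel_bound r (I : finType) (w : I -> cvert G r) (B : I -> cvert G r -> bool)
    (c : I -> R[i]) i0 :
  (forall k, K r k -> \sum_i c i * k (w i) = 0) -> c i0 != 0 ->
  (forall i j x, B i x -> B j x -> i = j) ->
  (forall i, B i (w i)) -> (forall i, 0 < d (cover_vert (w i))) ->
  \sum_i sqn (restr (B i) (kerproj (w i))) / d (cover_vert (w i)) <= #|I|%:R - 1.
Proof.
move=> ck ci0 Bd Bw dw.
under eq_bigr do rewrite -sqn_kerproj.
apply: (@trace_bound _ _ I (fun i => kerproj (w i)) B (fun i => conjc (c i)) i0) => //.
- by move=> i; exact: kerproj_ell2.
- by rewrite conjc_eq0.
- exact: kerproj_dependence.
- move=> i; apply: (@normc_restr_gt0 _ _ _ _ (w i)) => //; first exact: kerproj_ell2.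
  by rewrite kerproj_self -(rmorph0 (real_complex R)) (inj_eq (@complexI R)) gt_eqF.
Qed.

Definition base r : cvert G r := exist _ [::] isT.
Definition first_step r f : cvert G r := nbr (base r) f.
Definition branch r f (w : cvert G r) : bool := ohead (val w) == Some f.

Lemma val_first_step r f : src G f = r -> val (first_step r f) = [:: f].
Proof. by move=> hf; rewrite /first_step val_nbr// mv_nil. Qed.

Lemma cover_first_step r f : src G f = r -> cover_vert (first_step r f) = tgt G f.
Proof. by move=> hf; rewrite cover_nbr. Qed.

Lemma d_ge0 v : 0 <= d v.
Proof. by rewrite -(sqn_kerproj (base v)) sqn_ge0. Qed.

Lemma branch_first_step r f : src G f = r -> branch f (first_step r f).
Proof. by move=> hf; rewrite /branch val_first_step//= eqxx. Qed.

Lemma branch_uniq r f f' (w : cvert G r) : branch f w -> branch f' w -> f = f'.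
Proof. by move=> /eqP hf /eqP; rewrite hf => -[]. Qed.

Lemma reroot_base e : reroot (base (tgt G e)) = first_step (src G e) e.
Proof. by apply: val_inj; rewrite val_first_step. Qed.

(** Cutting the tree at one edge leaves two halves, and each half is a branch seen from the end
    lying in the other. *)
Lemma branch_reroot e (w : cvert G (tgt G e)) :
  branch e (reroot w) = ~~ branch (bar e) w.
Proof.
case: w => [[|x s] hs]; rewrite /branch /= ?eqxx//.
case: ifP => [/eqP xe|xe]; last first.
  by rewrite /= eqxx; apply/esym; apply: contraFN xe => /eqP[->].
move: hs; rewrite xe nbwalk_consE => /and3P[_ _]; rewrite erevK eqxx.
by case: s => //= y s /negPf ye; case: eqP => // -[] ee; rewrite ee eqxx in ye.
Qed.

(* [(mass e / d (tgt G e))] is [1 - p e] in the notation of the header. *)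
Definition mass e : R := sqn (restr (branch e) (kerproj (first_step (src G e) e))).

Lemma massE e v : src G e = v ->
  mass e = sqn (restr (branch e) (kerproj (first_step v e))).
Proof. by move=> <-. Qed.

Lemma mass_base e u : tgt G e = u ->
  mass e = sqn (restr (fun w => ~~ branch (bar e) w) (kerproj (base u))).
Proof.
move=> <-; rewrite /mass kerproj_reroot reroot_base -(sqn_reroot (restr _ _)).
by congr sqn; apply/funext => w; rewrite /restr /= branch_reroot.
Qed.

Lemma mass_le e : mass e <= d (tgt G e).
Proof.
rewrite (mass_base erefl) -(sqn_kerproj (base (tgt G e))).
by rewrite [leRHS](sqn_restrC (branch (bar e)) (kerproj_ell2 _)) lerDr sqn_ge0.
Qed.

(** Each term is the mass of [kerproj (base u)] in the branch behind [e]; these branches cover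
    everything but the base, which carries the mass (d u)^2. *)
Lemma mass_sum u :
  \sum_(e | tgt G e == u) (d u - mass e) = d u - d u ^+ 2.
Proof.
have dE : d u = sqn (kerproj (base u)) by rewrite sqn_kerproj.
rewrite (eq_bigr (fun e => sqn (restr (branch (bar e)) (kerproj (base u))))); last first.
  move=> e /eqP te; rewrite (mass_base te) {1}dE.
  by rewrite (sqn_restrC (branch (bar e)) (kerproj_ell2 _)) addrK.
rewrite {1}dE (@sqn_partition _ _ E (fun e => tgt G e == u)
  (fun e => branch (bar e)) _ (base u) (kerproj_ell2 _)) => //.
- rewrite kerproj_self /= expr0n addr0 sqr_sqrtr ?sqr_ge0// addrAC.
  by rewrite /cover_vert /= subrr add0r.
- case=> [[|f s] hs]; first by move/eqP; case; exact: val_inj.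
  move=> _; exists (bar f); rewrite /branch /= ?erevK//.
  by rewrite tgt_bar; case/andP: hs.
- by move=> e e' w hw hw'; apply: (can_inj (erevK G)); exact: branch_uniq hw hw'.
Qed.

(** Cutting off to a branch commutes with the operator except across the edge [f] from the base; the
    two [delta] terms are the defects at its ends. *)
Lemma jacobi_restr_branch v f h w : src G f = v ->
  A v (restr (branch f) h) w = (if branch f w then A v h w else 0)
   + ((wt G (bar f) * h (first_step v f)) * delta (base v) w
      - (wt G f * h (base v)) * delta (first_step v f) w).
Proof.
move=> hf; have rv : (base v == first_step v f) = false.
  by apply/eqP => /(congr1 val); rewrite val_first_step.
have b0 : false%:R = 0 :> R[i] by [].
have b1 : true%:R = 1 :> R[i] by [].
rewrite jacobi_coverE /delta.
have [->|wr] := eqVneq w (base v).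
  rewrite rv b0 b1 !mulr0 subr0 mulr1 !add0r.
  rewrite (bigD1 (bar f))/=; last by rewrite tgt_bar hf.
  rewrite erevK -/(first_step v f) {1}/restr branch_first_step//.
  rewrite big1 ?addr0// => e /andP[te ef].
  rewrite /restr /branch val_nbr ?src_bar; last exact/eqP.
  rewrite mv_nil /=; case: eqP; rewrite ?mulr0// => -[] /esym/eqP.
  by rewrite eq_sym bar_eq (negPf ef).
rewrite b0 mulr0 add0r; have [->|wf] := eqVneq w (first_step v f).
  rewrite branch_first_step// jacobi_coverE b1 mulr1 cover_first_step//.
  rewrite {1}/restr branch_first_step// -addrA; congr (_ + _).
  rewrite (bigD1 f)//= [in RHS](bigD1 f)//=.
  have -> : nbr (first_step v f) (bar f) = base v.
    apply: val_inj; rewrite val_nbr ?cover_first_step ?src_bar// val_first_step//=.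
    by rewrite -[[:: f]]/(rcons [::] f) mv_rcons erevK eqxx.
  rewrite {1}/restr /= mulr0 add0r addrAC subrr add0r.
  apply: eq_bigr => e /andP[/eqP te ef]; rewrite /restr /branch.
  rewrite val_nbr ?cover_first_step ?src_bar// val_first_step//.
  by rewrite -[[:: f]]/(rcons [::] f) mv_rcons erevK [f == e]eq_sym (negPf ef) /= eqxx.
rewrite b0 mulr0 subr0; case: ifPn => bw.
  rewrite jacobi_coverE {1}/restr bw; congr (_ + _); apply: eq_bigr => e /eqP te.
  rewrite /restr /branch val_nbr ?src_bar//.
  have : val w != [:: f].
    by apply: contra wf => /eqP ws; apply/eqP/val_inj; rewrite ws val_first_step.
  move: bw; rewrite /branch; case: (val w) => [//|x [|y s]] /= /eqP[->].
    by rewrite eqxx.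
  by rewrite mv_cons//= eqxx.
rewrite {1}/restr (negPf bw) mulr0 add0r big1// => e /eqP te.
rewrite /restr /branch val_nbr ?src_bar//.
have : val w != [::] by apply: contra wr => /eqP ws; apply/eqP/val_inj.
move: bw; rewrite /branch; case: (val w) => [//|x [|y s]] /= bw _.
  rewrite -[[:: x]]/(rcons [::] x) mv_rcons; case: (x == _); first by rewrite mulr0.
  by rewrite [ohead _]/= (negPf bw) mulr0.
by rewrite mv_cons//= (negPf bw) mulr0.
Qed.

(* Summation by parts on the branch [f]: only the edge [f] contributes. *)
Lemma wronskian v f h k : src G f = v -> K v h -> K v k ->
  conjc (wt G (bar f) * h (first_step v f)) * k (base v) =
  conjc (wt G f * h (base v)) * k (first_step v f).
Proof.
move=> hf Kh Kk; have [lh Ah] := Kh; have [lk Ak] := Kk.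
pose hB := restr (branch f) h.
have lB : ell2 hB by exact: ell2_restr.
have e1 : A v hB = fun w => lambda%:C * hB w +
   ((wt G (bar f) * h (first_step v f)) * delta (base v) w
      + (- (wt G f * h (base v))) * delta (first_step v f) w).
  apply/funext => w; rewrite jacobi_restr_branch// mulNr; congr (_ + _).
  by rewrite /hB /restr Ah; case: ifP => //; rewrite mulr0.
(* The added 0 gives the shape that [inner_linr] rewrites. *)
have e2 : A v k = fun w => lambda%:C * k w + 0.
  by apply/funext => w; rewrite Ak addr0.
have := (proj1 (hroot v)) hB k lB lk; rewrite e1 e2.
have l1 : ell2 (fun w => (- (wt G f * h (base v))) * delta (first_step v f) w).
  exact: ell2Z (ell2_delta _).
rewrite inner_linl//; last by apply: ell2P => //; exact: ell2_delta.
rewrite inner_linl//; last exact: ell2_delta.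
have -> : (fun w => (- (wt G f * h (base v))) * delta (first_step v f) w) =
   (fun w => (- (wt G f * h (base v))) * delta (first_step v f) w + 0).
  by apply/funext => w; rewrite addr0.
rewrite inner_linl//; [|exact: ell2_delta|exact: ell20].
rewrite inner_linr//; last exact: ell20.
rewrite inner0l inner0r !addr0 !inner_delta conjc_real conjcN mulNr => /eqP.
by rewrite -subr_eq0 addrAC subrr add0r subr_eq0 => /eqP.
Qed.

(* The constant [t_e] of the header. *)
Definition ratio e : R[i] :=
  wt G e * kerproj (base (tgt G e)) (first_step (tgt G e) (bar e)) / (d (tgt G e))%:C.

Lemma dC_neq0 v : 0 < d v -> (d v)%:C != 0 :> R[i].
Proof.
by move=> dv; rewrite -(rmorph0 (real_complex R)) (inj_eq (@complexI R)) gt_eqF.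
Qed.

Lemma ratioP e u k : tgt G e = u -> 0 < d u -> K u k ->
  wt G e * k (first_step u (bar e)) = ratio e * k (base u).
Proof.
move=> eu; case: u / eu k => k du Kk; have dC := dC_neq0 du.
(* [wronskian] against [kerproj (base _)] gives the claim with the conjugate constant; [W] at that
   same vector then shows that [ratio e] is real. *)
have W k' : K (tgt G e) k' -> wt G e * k' (first_step (tgt G e) (bar e)) =
    conjc (ratio e) * k' (base (tgt G e)).
  move=> Kk'.
  have := @wronskian _ (bar e) (kerproj (base _)) k' (src_bar _ _) (kerproj_eigen _) Kk'.
  rewrite erevK kerproj_self -wt_conj [in RHS]conjcM conjcK conjc_real /ratio.
  rewrite [conjc (_ / _)]conjcM conjc_inv conjc_real => h.
  by rewrite -mulrA [_^-1 * _]mulrC mulrA h; field.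
rewrite W//; congr (_ * _).
have := W _ (kerproj_eigen (base (tgt G e))); rewrite kerproj_self => h.
by rewrite {2}/ratio h /cover_vert /= mulfK.
Qed.

(** [ratioP] is applied at both ends of [e] to one eigenfunction, non-zero at [tgt G e], and its
    values are cancelled. *)
Lemma ratioM e : 0 < d (src G e) -> 0 < d (tgt G e) ->
  ratio e * ratio (bar e) = wt G e * wt G (bar e).
Proof.
move=> ds dt; pose k := kerproj (base (tgt G e)).
have kt : k (base (tgt G e)) = (d (tgt G e))%:C by rewrite /k kerproj_self.
have h1 := ratioP erefl dt (kerproj_eigen (base (tgt G e))).
have h2 := @ratioP (bar e) (src G e) _ (tgt_bar _ _) ds
  (eigen_unreroot (kerproj_eigen (base (tgt G e)))).
move: h2; rewrite erevK /= -reroot_base rerootK -/k.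
have -> : unreroot (base (src G e)) = first_step (tgt G e) (bar e).
  by apply: val_inj; rewrite val_first_step ?src_bar.
move: h1; rewrite -/k kt => h1 h2; apply: (mulIf (dC_neq0 dt)).
by rewrite mulrAC -h1 -[RHS]mulrA h2; ring.
Qed.

(** The eigenvalue equation of [kerproj (base u)] at the base, divided by its value [d u] there. *)
Lemma ratio_sum u : 0 < d u ->
  lambda%:C = (pot G u)%:C + \sum_(e | tgt G e == u) ratio e.
Proof.
move=> du; apply: (mulIf (dC_neq0 du)).
have dE : (d u)%:C = kerproj (base u) (base u) by rewrite kerproj_self.
rewrite {1}dE -(proj2 (kerproj_eigen (base u))) jacobi_coverE -dE mulrDl; congr (_ + _).
rewrite mulr_suml; apply: eq_bigr => e /eqP te.
by rewrite (ratioP te du (kerproj_eigen _)) -dE.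
Qed.

Lemma ratio_eq0 e : d (src G e) = 0 -> ratio e = 0.
Proof.
move=> ds; rewrite /ratio (eigen_eq0 _ (kerproj_eigen _)) ?mulr0 ?mul0r//.
by rewrite cover_first_step ?src_bar// tgt_bar.
Qed.

Lemma wt_bar_neq0 e : wt G e != 0 -> wt G (bar e) != 0.
Proof. by rewrite -wt_conj conjc_eq0. Qed.

(** This is p e + p (bar e) >= 1 of the header. The two vertices are the ends of [e], each with its
    own half of the tree, and [ratioP] is the relation between them. *)
Lemma mass_edge e : 0 < d (src G e) -> 0 < d (tgt G e) -> wt G e != 0 ->
  mass e / d (tgt G e) + mass (bar e) / d (src G e) <= 1.
Proof.
move=> ds dt we; set v := src G e.
have := @kernel_bound v bool (fun b => if b then first_step v e else base v)
  (fun b w => if b then branch e w else ~~ branch e w)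
  (fun b => if b then wt G (bar e) else - ratio (bar e)) true.
rewrite !big_bool /= card_bool (mass_base (tgt_bar _ _)) erevK (massE erefl).
rewrite cover_first_step// [2%:R - 1](_ : _ = 1 :> R); last by rewrite mulr2n addrK.
apply.
- move=> k Kk; rewrite big_bool /=.
  have := @ratioP (bar e) v k (tgt_bar _ _) ds Kk; rewrite erevK => ->.
  by rewrite mulNr subrr.
- exact: wt_bar_neq0.
- by move=> [] [] w //= h1 h2; move: h2; rewrite ?h1 // (negPf h1).
- by case; rewrite ?branch_first_step.
- by case; rewrite ?cover_first_step.
Qed.

Lemma mass_boundary v
    (F := [set f | [&& src G f == v, 0 < d (tgt G f) & wt G f != 0]]%SET) :
  d v = 0 -> (0 < #|F|)%N ->
  \sum_(f in F) mass f / d (tgt G f) <= #|F|%:R - 1.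
Proof.
move=> dv /card_gt0P[f0 Ff0].
have FP (i : 'I_#|F|) : [/\ src G (enum_val i) = v, 0 < d (tgt G (enum_val i)) &
    wt G (enum_val i) != 0].
  by have := enum_valP i; rewrite inE => /and3P[/eqP].
rewrite big_enum_val /= -[X in X%:R - 1]card_ord.
rewrite (eq_bigr (fun i : 'I_#|F| =>
  sqn (restr (branch (enum_val i)) (kerproj (first_step v (enum_val i))))
    / d (cover_vert (first_step v (enum_val i))))); last first.
  by move=> i _; have [sv _ _] := FP i; rewrite cover_first_step// (massE sv).
apply: (@kernel_bound v 'I_#|F| (fun i => first_step v (enum_val i))
  (fun i => @branch v (enum_val i)) (fun i => wt G (bar (enum_val i)))
  (enum_rank_in Ff0 f0)).
(* The relation is the eigenvalue equation at the base, where [k] vanishes; terms outside [F] have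
   zero weight or an uncharged end. *)
- move=> k Kk; rewrite -(big_enum_val (fun f => wt G (bar f) * k (first_step v f))) /=.
  have k0 : k (base v) = 0 by exact: eigen_eq0 Kk.
  have := proj2 Kk (base v); rewrite jacobi_coverE k0 !mulr0 add0r.
  rewrite (reindex_inj (can_inj (erevK G))) /= => kv; rewrite -[RHS]kv.
  rewrite big_mkcond [RHS]big_mkcond; apply: eq_bigr => f _.
  rewrite inE /cover_vert /= tgt_bar erevK; case: eqP => //= sf.
  case: ltP => [_|df] /=; last first.
    rewrite (eigen_eq0 _ Kk) ?mulr0// cover_first_step//.
    by apply/eqP; rewrite eq_le df d_ge0.
  by case: eqP => //= wf; rewrite -wt_conj wf conjc0 mul0r.
- by apply: wt_bar_neq0; case: (FP (enum_rank_in Ff0 f0)).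
- by move=> i j w hi hj; apply: enum_val_inj; exact: branch_uniq hi hj.
- by move=> i; apply: branch_first_step; case: (FP i).
- by move=> i; rewrite cover_first_step; case: (FP i).
Qed.

End LocalRelations.

(** * Summing the local bounds over the finite graph *)

Section Counting.
Context {R : realType} {V E : finType} (G : graph R V E) (lambda : R) (d : V -> R).
Hypothesis hroot : forall v, spectral_root G lambda d v.

Local Notation bar := (erev G).

Definition charged : {set V} := [set v | 0 < d v]%SET.
Definition inner_edges : {set E} :=
  [set e | [&& 0 < d (src G e), 0 < d (tgt G e) & wt G e != 0]]%SET.
(* One edge out of each pair [e], [erev G e]. *)
Definition oriented_edges : {set E} :=
  [set e in inner_edges | (enum_rank e < enum_rank (bar e))%N]%SET.
Definition boundary_edges : {set E} :=
  [set f | [&& d (src G f) == 0, 0 < d (tgt G f) & wt G f != 0]]%SET.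
Definition boundary : {set V} := [set src G f | f in boundary_edges]%SET.

Lemma rank_bar e :
  (enum_rank (bar e) < enum_rank e)%N = ~~ (enum_rank e < enum_rank (bar e))%N.
Proof.
rewrite -leqNgt [RHS]leq_eqVlt; case: eqVneq => // h.
by have := bar_neq G e; rewrite (enum_rank_inj (val_inj h)) eqxx.
Qed.

Lemma inner_edges_bar e : (bar e \in inner_edges) = (e \in inner_edges).
Proof.
rewrite !inE tgt_bar src_bar andbCA; congr [&& _, _ & _].
by rewrite -wt_conj conjc_eq0.
Qed.

Lemma sum_inner_edges (F : E -> R) :
  \sum_(e in inner_edges) F e = \sum_(e in oriented_edges) (F e + F (bar e)).
Proof.
rewrite (bigID (fun e => (enum_rank e < enum_rank (bar e))%N)) /= big_split /=.
congr (_ + _); first by apply: eq_bigl => e; rewrite [RHS]inE.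
rewrite (reindex_inj (can_inj (erevK G))) /=; apply: eq_bigl => e.
by rewrite erevK inner_edges_bar [RHS]inE rank_bar negbK.
Qed.

Lemma sum_d_le :
  \sum_v d v + #|oriented_edges|%:R + #|boundary|%:R <= #|charged|%:R.
Proof.
pose p e := (d (tgt G e) - mass hroot e) / d (tgt G e).
have p0 e : 0 <= p e by rewrite mulr_ge0 ?invr_ge0 ?(d_ge0 hroot)// subr_ge0 mass_le.
have pE e : 0 < d (tgt G e) -> p e = 1 - mass hroot e / d (tgt G e).
  by move=> dt; rewrite /p mulrBl divff ?gt_eqF.
have sumX : \sum_(e | 0 < d (tgt G e)) p e = #|charged|%:R - \sum_v d v.
  rewrite (partition_big (tgt G) (mem charged)) /=; last by move=> e; rewrite inE.
  rewrite (bigID (mem charged) _ d) /= [X in _ - (_ + X)]big1 ?addr0; last first.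
    move=> v; rewrite inE -leNgt => dv; apply/eqP.
    by rewrite eq_le dv (d_ge0 hroot).
  rewrite -sumr_const -sumrB; apply: eq_bigr => u; rewrite inE => du.
  transitivity (\sum_(e | tgt G e == u) (d u - mass hroot e) / d u).
    rewrite big_mkcond [RHS]big_mkcond; apply: eq_bigr => e _.
    by case: (eqVneq (tgt G e) u) => [te|]; rewrite ?andbF ?te ?du // /p te.
  by rewrite -mulr_suml mass_sum mulrBl divff ?gt_eqF// expr2 mulfK ?gt_eqF.
have inn : #|oriented_edges|%:R <= \sum_(e in inner_edges) p e.
  rewrite sum_inner_edges -sumr_const; apply: ler_sum => e.
  rewrite !inE => /andP[/and3P[ds dt we] _].
  rewrite !pE ?tgt_bar//; have := mass_edge hroot ds dt we; lra.
have bnd : #|boundary|%:R <= \sum_(e in boundary_edges) p e.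
  rewrite (partition_big (src G) (mem boundary)) /=; last first.
    by move=> e he; exact: imset_f.
  rewrite -sumr_const; apply: ler_sum => v /imsetP[f0 f0b fv].
  have dv : d v = 0 by move: f0b; rewrite inE -fv => /andP[/eqP].
  pose F := [set f | [&& src G f == v, 0 < d (tgt G f) & wt G f != 0]]%SET.
  have F0 : (0 < #|F|)%N.
    apply/card_gt0P; exists f0; move: f0b; rewrite !inE fv eqxx.
    by case/and3P => _ -> ->.
  have := mass_boundary hroot dv F0; rewrite -/F => hb.
  rewrite (eq_bigl (mem F)); last first.
    move=> f; rewrite !inE; case: (eqVneq (src G f) v) => [->|_]; last by rewrite andbF.
    by rewrite dv eqxx andbT.
  rewrite (eq_bigr (fun f => 1 - mass hroot f / d (tgt G f))); last first.
    by move=> f; rewrite !inE => /and3P[_ dt _]; rewrite pE.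
  by rewrite sumrB sumr_const; lra.
(* The two sets of edges are disjoint, since the charge of the source differs, and the remaining
   terms are non-negative. *)
have : \sum_(e in inner_edges) p e + \sum_(e in boundary_edges) p e <=
    \sum_(e | 0 < d (tgt G e)) p e.
  rewrite [leRHS](bigID (mem inner_edges)) /=; apply: lerD.
    rewrite [leRHS]big_mkcond [leLHS]big_mkcond; apply: ler_sum => e _.
    case: ifP => [ein|_]; last by case: ifP.
    have dt : 0 < d (tgt G e) by move: ein; rewrite inE => /and3P[].
    by rewrite dt.
  rewrite [leRHS]big_mkcond [leLHS]big_mkcond; apply: ler_sum => e _.
  case: ifP => [|_]; last by case: ifP.
  by rewrite !inE => /and3P[/eqP -> -> _]; rewrite ltxx.
rewrite sumX; lra.
Qed.

End Counting.

(** * Eigenvectors on the finite graph with values in [W] *)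

Section TwistedKernel.
Context {R : realType} {V E : finType} (G : graph R V E) (lambda : R) (d : V -> R).
Hypothesis hroot : forall v, spectral_root G lambda d v.
Context {W : vectType R[i]} (rho : E -> 'End(W)).
Hypothesis rhoK : forall e x, rho e (rho (erev G e) x) = x.

Local Notation bar := (erev G).
Local Notation ratio := (ratio hroot).

(** One [W]-valued equation for each element, so the solutions have codimension at most
    [#|constraint|] times the dimension of [W]. *)
Definition constraint : finType :=
  ({v | v \notin charged d} + {e | e \in oriented_edges G d} +
   {v | v \in boundary G d})%type.

Definition constraint_fun (eta : {ffun V -> W}) : {ffun constraint -> W} :=
  [ffun i => match i with
   | inl (inl v) => eta (val v)
   | inl (inr e) => wt G (val e) *: rho (val e) (eta (src G (val e)))
                    - ratio (val e) *: eta (tgt G (val e))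
   | inr v => \sum_(e | tgt G e == val v) wt G e *: rho e (eta (src G e))
   end].

Fact constraint_fun_linear : linear constraint_fun.
Proof.
move=> c f g; apply/ffunP => -[[v|e]|v]; rewrite !ffunE //=.
- rewrite linearP !scalerDr !scalerA opprD addrACA scalerN !scalerA.
  by rewrite [c * wt _ _]mulrC [c * ratio _]mulrC.
- rewrite scaler_sumr -big_split /=; apply: eq_bigr => e _.
  by rewrite !ffunE linearP scalerDr !scalerA [c * _]mulrC.
Qed.

HB.instance Definition _ := GRing.isLinear.Build R[i] {ffun V -> W}
  {ffun constraint -> W} _ constraint_fun constraint_fun_linear.

Lemma constraint_eigen eta : constraint_fun eta = 0 -> forall u,
  (pot G u)%:C *: eta u + \sum_(e | tgt G e == u) wt G e *: rho e (eta (src G e))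
  = lambda%:C *: eta u.
Proof.
move=> /ffunP c0.
have off v : d v = 0 -> eta v = 0.
  move=> dv; have hv : v \notin charged d by rewrite inE dv ltxx.
  by have := c0 (inl (inl (exist _ v hv))); rewrite !ffunE.
have dP v : d v = 0 \/ 0 < d v.
  by have := d_ge0 hroot v; rewrite le_eqVlt => /orP[/eqP<-|]; [left|right].
have oriented e : e \in oriented_edges G d ->
    wt G e *: rho e (eta (src G e)) = ratio e *: eta (tgt G e).
  move=> he; have := c0 (inl (inr (exist _ e he))); rewrite !ffunE /=.
  by move/eqP; rewrite subr_eq0 => /eqP.
move=> u; case: (dP u) => du.
  rewrite (off u du) !scaler0 add0r.
  case: (boolP (u \in boundary G d)) => [hu|hu].
    by have := c0 (inr (exist _ u hu)); rewrite !ffunE.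
  apply: big1 => e /eqP te.
  case: (dP (src G e)) => ds; first by rewrite (off _ ds) linear0 scaler0.
  case: (eqVneq (wt G e) 0) => [->|we]; first by rewrite scale0r.
  (* A charged neighbour across a non-zero weight would put [u] in the boundary. *)
  case/negP: hu; apply/imsetP; exists (bar e); last by rewrite src_bar.
  by rewrite inE src_bar tgt_bar te du eqxx ds wt_bar_neq0.
(* At a charged vertex the equation now splits into one identity per edge. *)
rewrite (ratio_sum hroot du) scalerDl; congr (_ + _).
rewrite scaler_suml; apply: eq_bigr => e /eqP te.
case: (dP (src G e)) => ds.
  by rewrite (off _ ds) linear0 scaler0 (ratio_eq0 hroot ds) scale0r.
case: (eqVneq (wt G e) 0) => [we|we].
  by rewrite /ratio we !mul0r !scale0r.
have dt : 0 < d (tgt G e) by rewrite te.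
have ein : e \in inner_edges G d by rewrite inE ds dt we.
case: (boolP (enum_rank e < enum_rank (bar e))%N) => rk.
  by rewrite -te; apply: oriented; rewrite inE ein.
(* Here the relation is imposed on [bar e] only: [rho e] inverts it and [ratioM] converts its
   constant into that of [e]. *)
have := oriented (bar e); rewrite inE inner_edges_bar ein erevK rank_bar rk.
rewrite src_bar tgt_bar te => /(_ isT) /(congr1 (rho e)).
rewrite !linearZ /= rhoK => h.
have r0 : ratio (bar e) != 0.
  apply: contraNneq we => r0; have := ratioM hroot ds dt.
  rewrite r0 mulr0 => /esym/eqP; rewrite mulf_eq0 => /orP[//|wb].
  by move: wb; rewrite -wt_conj conjc_eq0.
apply: (scalerI r0); rewrite scalerA mulrC -scalerA -h !scalerA.
by rewrite -(ratioM hroot ds dt) mulrC.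
Qed.

(** The embedding [J] lets one bound serve operators on other presentations of the space: it is the
    identity for [G] and the quotient, and uncurrying for the lift. *)
Lemma twisted_kernel_bound (U : vectType R[i]) (A : 'End(U))
    (J : 'Hom({ffun V -> W}, U)) :
  (forall eta : {ffun V -> W}, J eta = 0 -> eta = 0) ->
  (forall eta : {ffun V -> W}, (forall u, (pot G u)%:C *: eta u
      + \sum_(e | tgt G e == u) wt G e *: rho e (eta (src G e))
      = lambda%:C *: eta u) -> A (J eta) = lambda%:C *: J eta) ->
  (\dim {:W})%:R * \sum_v d v <= (multiplicity A lambda)%:R.
Proof.
move=> Jinj Aeig; pose C := linfun constraint_fun; pose K := lker C.
have CK eta : eta \in K -> constraint_fun eta = 0.
  by rewrite memv_ker lfunE => /eqP.
(* Rank-nullity, the rank being at most the dimension of the codomain. *)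
have dimK : (#|V| * \dim {:W} <= \dim K + #|constraint| * \dim {:W})%N.
  have := limg_ker_dim C fullv; rewrite capfv -/K.
  rewrite [\dim {:{ffun V -> W}}]dimvf => dE.
  have -> : (#|V| * \dim {:W})%N = dim {ffun V -> W} by rewrite dimvf.
  rewrite -dE leq_add2l (leq_trans (dimvS (subvf _)))//.
  by rewrite !dimvf.
have dimJ : \dim (J @: K) = \dim K.
  have J0 : lker J = 0%VS.
    apply/eqP; rewrite -subv0; apply/subvP => eta.
    by rewrite memv_ker => /eqP /Jinj ->; exact: mem0v.
  by apply: limg_dim_eq; rewrite J0 capv0.
have JK : (J @: K <= lker (lambda%:C *: \1%VF - A))%VS.
  apply/subvP => _ /memv_imgP[eta etaK ->]; rewrite memv_ker.
  rewrite !lfun_simp Aeig ?subrr//.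
  exact/constraint_eigen/CK.
have mult : (\dim K <= multiplicity A lambda)%N.
  by rewrite -dimJ; exact: dimvS.
have cardI : #|constraint| =
    (#|V| - #|charged d| + #|oriented_edges G d| + #|boundary G d|)%N.
  rewrite /constraint !card_sum !card_sig; congr (_ + _ + _)%N.
  rewrite -(cardsC (charged d)) addKn.
  by apply: eq_card => v; rewrite !inE.
have Xle : (#|charged d| <= #|V|)%N by exact: max_card.
have cnt := sum_d_le hroot.
have dimK' : (#|V|%:R : R) * (\dim {:W})%:R <=
    (\dim K)%:R + (#|V|%:R - #|charged d|%:R + #|oriented_edges G d|%:R +
      #|boundary G d|%:R) * (\dim {:W})%:R.
  by move: dimK; rewrite cardI -(ler_nat R) !natrD !natrM !natrD natrB.
have W0 : 0 <= (\dim {:W})%:R :> R by [].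
apply: (@le_trans _ _ (\dim K)%:R); last by rewrite ler_nat.
move: cnt dimK' W0; move: (\sum_v d v) (\dim {:W})%:R => s w; nra.
Qed.

End TwistedKernel.

(** * The three operators: base, quotient and lift *)

Section LiftOperators.
Context {R : realType} {V E : finType} (G : graph R V E) (lambda : R) (d : V -> R).
Hypothesis hroot : forall v, spectral_root G lambda d v.
Context {n : nat} (H : nlift G n).

Lemma base_multiplicity : \sum_v d v <= (multiplicity (jacobi_op G) lambda)%:R.
Proof.
rewrite -[leLHS]mul1r.
have := @twisted_kernel_bound R V E G lambda d hroot R[i]^o (fun=> \1%VF) _ _
  (jacobi_op G) \1%VF.
rewrite dimvf; apply.
- by move=> e x; rewrite !id_lfunE.
- by move=> eta; rewrite id_lfunE.
- move=> eta he; rewrite !id_lfunE; apply/ffunP => u.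
  rewrite jacobi_opE jacobi_finE [RHS]ffunE -he; congr (_ + _).
  by apply: eq_bigr => e _; rewrite id_lfunE.
Qed.

(** [Cn0] is the kernel of a single linear form. *)
Lemma dim_Cn0 : (n.-1 <= \dim (Cn0 (R := R) (n := n)))%N.
Proof.
have := limg_ker_dim (linfun (@ones_dot R n)) fullv.
rewrite capfv dimvf => h.
have hn : dim {ffun 'I_n -> R[i]^o} = n by rewrite /dim /= card_ord muln1.
have h1 := dimvS (subvf (linfun (@ones_dot R n) @: fullv)).
rewrite dimvf in h1.
have d1 : dim R[i]^o = 1%N by [].
move: h; rewrite hn => h.
rewrite -subn1 leq_subLR -[leqLHS]h addnC leq_add2r.
by rewrite (leq_trans h1) ?d1.
Qed.

Lemma quot_multiplicity :
  n.-1%:R * \sum_v d v <= (multiplicity (quot_jacobi_op H) lambda)%:R.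
Proof.
have s0 : 0 <= \sum_v d v by apply: sumr_ge0 => v _; exact: (d_ge0 hroot).
apply: (@le_trans _ _ ((\dim {:subvs_of (Cn0 (R := R) (n := n))})%:R * \sum_v d v)).
  by rewrite ler_wpM2r// ler_nat dimvf dim_Cn0.
apply: (@twisted_kernel_bound R V E G lambda d hroot _ (fun e => rho (lperm H e)) _ _
  (quot_jacobi_op H) \1%VF).
- move=> e x; suff : vsval (rho (lperm H e) (rho (lperm H (erev G e)) x)) = vsval x.
    exact: val_inj.
  rewrite !rhoE; apply/ffunP => j.
  by rewrite !ffunE lperm_erev invgK permKV.
- by move=> eta; rewrite id_lfunE.
- move=> eta he; rewrite !id_lfunE; apply/ffunP => u.
  by rewrite quot_jacobi_opE [RHS]ffunE -he.
Qed.

Fact perm_fun_linear (s : {perm 'I_n}) : linear (@perm_fun R n s).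
Proof. by move=> c x y; apply/ffunP => j; rewrite !ffunE. Qed.

HB.instance Definition _ s := GRing.isLinear.Build R[i] {ffun 'I_n -> R[i]^o}
  {ffun 'I_n -> R[i]^o} _ (@perm_fun R n s) (perm_fun_linear s).

Definition uncurry_fun (eta : {ffun V -> {ffun 'I_n -> R[i]^o}}) :
  {ffun V * 'I_n -> R[i]^o} := [ffun x => eta x.1 x.2].

Fact uncurry_fun_linear : linear uncurry_fun.
Proof. by move=> c x y; apply/ffunP => j; rewrite !ffunE. Qed.

HB.instance Definition _ := GRing.isLinear.Build R[i]
  {ffun V -> {ffun 'I_n -> R[i]^o}} {ffun V * 'I_n -> R[i]^o} _
  uncurry_fun uncurry_fun_linear.

(** Obtained directly from the action of the permutations on all of C^n, without going through the
    decomposition into base and quotient. *)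
Lemma lift_multiplicity :
  n%:R * \sum_v d v <= (multiplicity (jacobi_op (lift_graph H)) lambda)%:R.
Proof.
have hn : \dim {:{ffun 'I_n -> R[i]^o}} = n by rewrite dimvf /dim /= card_ord muln1.
rewrite -{1}hn.
apply: (@twisted_kernel_bound R V E G lambda d hroot _
  (fun e => linfun (@perm_fun R n (lperm H e))) _ _ _ (linfun uncurry_fun)).
- move=> e x; rewrite !lfunE; apply/ffunP => j.
  by rewrite !ffunE lperm_erev invgK permKV.
- move=> eta; rewrite lfunE => /ffunP h; apply/ffunP => u; apply/ffunP => j.
  by have := h (u, j); rewrite !ffunE.
- move=> eta he.
  have -> : linfun uncurry_fun eta = uncurry_fun eta by rewrite lfunE.
  apply/ffunP => -[u j].
  rewrite jacobi_opE jacobi_finE !ffunE /=.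
  have /ffunP/(_ j) := he u; rewrite !ffunE sum_ffunE => <-; congr (_ + _).
  (* Above each [e] ending at [u], exactly one edge of the lift ends at [(u, j)]: the one from the
     preimage of [j]. *)
  transitivity (\sum_(e | tgt G e == u) \sum_(i | lperm H e i == j)
     wt G e * eta (src G e) i).
    rewrite pair_big_dep /=; apply: eq_big => [[e i]|[e i] _] //=.
    by rewrite ffunE.
  apply: eq_bigr => e _; rewrite (big_pred1 ((lperm H e)^-1%g j)) ?ffunE ?lfunE ?ffunE//.
  by move=> i /=; rewrite (can2_eq (permK _) (permKV _)).
Qed.

End LiftOperators.

Theorem theorem3p2 (R : realType) (V E : finType) (G : graph R V E)
    (hG : connected_graph G) (n : nat) (hn : (1 <= n)%N) (H : nlift G n)
    (r : V) (mu : V -> {measure set R -> \bar R})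
    (hmu : spectral_measures G r mu)
    (lambda : R) (hlambda : point_spectrum (jacobi (universal_cover G r)) lambda) :
  [/\ (#|V|%:R%:E * density_of_states mu [set lambda]
        <= (multiplicity (jacobi_op G) lambda)%:R%:E)%E,
      ((n.-1)%:R%:E * (#|V|%:R%:E * density_of_states mu [set lambda])
        <= (multiplicity (quot_jacobi_op H) lambda)%:R%:E)%E
    & (n%:R%:E * (#|V|%:R%:E * density_of_states mu [set lambda])
        <= (multiplicity (jacobi_op (lift_graph H)) lambda)%:R%:E)%E].
Proof.
pose d u := fine (mu u [set lambda]).
have hroot v : spectral_root G lambda d v.
  exact: spectral_root_connected hG (spectral_measures_root lambda hmu).
have -> : (#|V|%:R%:E * density_of_states mu [set lambda] = (\sum_u d u)%:E)%E.
  (* The root shows that [V] is non-empty, so the normalisation of the density of states cancels. *)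
  have V0 : #|V|%:R != 0 :> R by rewrite pnatr_eq0 -lt0n; apply/card_gt0P; exists r.
  rewrite /density_of_states muleA -EFinM divff// mul1e -sumEFin.
  by apply: eq_bigr => u _; rewrite fineK// (spectral_measure_fin lambda hG hmu).
split.
- by rewrite lee_fin base_multiplicity.
- by rewrite -EFinM lee_fin quot_multiplicity.
- by rewrite -EFinM lee_fin lift_multiplicity.
Qed.
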